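(* Let $(M,L)$ and $(M,\widetilde L)$ be conformally related Finsler manifolds, and assume that the $\pi$-tensor field $\mathcal{A}$ (defined in the context) vanishes. Then $(M,L)$ is a Berwald manifold if and only if $(M,\widetilde{L})$ is a Berwald manifold; likewise, $(M,L)$ is a $C^{h}$-recurrent manifold if and only if $(M,\widetilde{L})$ is a $C^{h}$-recurrent manifold.
   Context: $M$ is a real paracompact $C^\infty$ manifold of finite dimension $n$; all objects are $C^\infty$. $\pi:\mathcal{T}M\to M$ is the bundle of nonzero tangent vectors, $\pi^{-1}(TM)$ the pullback of $TM$ by $\pi$. Sections of $\pi^{-1}(TM)$ are called $\pi$-vector fields; tensor fields and forms on $\pi^{-1}(TM)$ are $\pi$-tensor fields, $\pi$-forms; $\overline\eta(u)=(u,u)$. $\rho:T(\mathcal{T}M)\to\pi^{-1}(TM)$ is $\rho=(\pi_{\mathcal{T}M},d\pi)$ and $\gamma:\pi^{-1}(TM)\to T(\mathcal{T}M)$ is the vertical lift. For a linear connection $D$ on $\pi^{-1}(TM)$, $K(X):=D_X\overline\eta$; $D$ is regular if $T(\mathcal{T}M)=V(\mathcal{T}M)\oplus H(\mathcal{T}M)$ with $H=\ker K$, $V$ the vertical bundle, and then $\beta:=(\rho|_{H})^{-1}$. Torsion: $\mathbf{T}(X,Y)=D_X\rho Y-D_Y\rho X-\rho[X,Y]$, $Q(\overline X,\overline Y)=\mathbf{T}(\beta\overline X,\beta\overline Y)$, $T(\overline X,\overline Y)=\mathbf{T}(\gamma\overline X,\beta\overline Y)$. $(M,L)$ is a Finsler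 manifold with Finsler metric $g$ on $\pi^{-1}(TM)$. The Cartan connection $\nabla$ is the unique regular connection with $\nabla g=0$, $Q=0$ and $g(T(\overline X,\overline Y),\overline Z)=g(T(\overline X,\overline Z),\overline Y)$; $T$, $\beta$ are those of $\nabla$. $(M,L)$ is Berwald if $\nabla_{\beta\overline X}T=0$ for all $\overline X$. It is $C^h$-recurrent if $\nabla_{\beta\overline X}T=\lambda_o(\overline X)T$ for all $\overline X$, for some $\pi$-form $\lambda_o$ of order one. $(M,L)$ and $(M,\widetilde L)$ are conformally related if $\widetilde g=e^{2\sigma(x)}g$ for a positive differentiable function $\sigma$ on $M$; objects of $(M,\widetilde L)$ carry a tilde. Put $B(\overline X,\overline Y):=\widetilde\nabla_{\beta\overline X}\overline Y-\nabla_{\beta\overline X}\overline Y$, $N(\overline X):=B(\overline X,\overline\eta)$, $U(\beta\overline X,\overline Y):=B(\overline X,\overline Y)-\nabla_{\gamma N\overline X}\overline Y$, and $$\mathcal{A}(\overline X,\overline Y,\overline Z):=T(U(\beta\overline X,\overline Y),\overline Z)+T(U(\beta\overline X,\overline Z),\overline Y)-U(\beta\overline X,T(\overline Y,\overline Z)).$$ *)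

(* Defs.v *)
From HB Require Import structures.
From mathcomp Require Import all_boot all_order all_algebra.
From mathcomp Require Import all_classical all_reals all_analysis.

Set Implicit Arguments.
Unset Strict Implicit.
Unset Printing Implicit Defensive.

Import Order.TTheory GRing.Theory Num.Theory numFieldNormedType.Exports.

Local Open Scope classical_set_scope.
Local Open Scope ring_scope.

(** * Smooth functions on open sets of R^m *)

Definition iter_partial (R : realType) (m : nat) (s : seq 'I_m)
    (f : 'rV[R]_m -> R) : 'rV[R]_m -> R :=
  foldr (fun i h => 'D_(delta_mx 0 i : 'rV[R]_m) h) f s.

(* Requiring every iterated partial derivative to be differentiable is the
   same as requiring all of them to exist and be continuous. *)
Definition smooth_on (R : realType) (m : nat) (W : set 'rV[R]_m)
    (f : 'rV[R]_m -> R) : Prop :=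
  forall (s : seq 'I_m) x, W x -> differentiable (iter_partial s f) x.

(** * Charts, smooth functions and tangent vectors *)

Record chart (R : realType) (N : Type) (m : nat) := Chart {
  dom : set N;
  coord : N -> 'rV[R]_m
}.

(* [local_expr c p F h]: near [p], the expression of [F] in [c] is the smooth
   function [h]. *)
Definition local_expr (R : realType) (N : Type) (m : nat) (c : chart R N m)
    (p : N) (F : N -> R) (h : 'rV[R]_m -> R) : Prop :=
  exists W : set 'rV[R]_m,
    [/\ open W, W (coord c p), smooth_on W h &
        forall q, dom c q -> W (coord c q) -> F q = h (coord c q)].

Definition smooth_at (R : realType) (N : Type) (m : nat)
    (A : set (chart R N m)) (p : N) (F : N -> R) : Prop :=
  forall c, A c -> dom c p -> exists h, local_expr c p F h.

Definition smooth (R : realType) (N : Type) (m : nat)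
    (A : set (chart R N m)) (F : N -> R) : Prop :=
  forall p, smooth_at A p F.

(* Tangent vectors are operators on (germs of) smooth functions.  They are
   represented by operators on all functions, with the value 0 on functions
   that are not smooth near the base point, so that equality of tangent
   vectors is Leibniz equality. *)
Definition tvec (R : realType) (N : Type) : Type := (N -> R) -> R.

HB.instance Definition _ (R : realType) (N : Type) :=
  GRing.Lmodule.copy (tvec R N) ((N -> R) -> R^o).
Definition on_smooth (R : realType) (N : Type) (m : nat)
    (A : set (chart R N m)) (p : N) (v : tvec R N) : tvec R N :=
  fun F => if `[< smooth_at A p F >] then v F else 0.

(* [v] is the directional derivative sum_i y_i d/dx^i at [p] in every chart
   around [p] ([y] depends on the chart). *)
Definition tangent (R : realType) (N : Type) (m : nat)
    (A : set (chart R N m)) (p : N) (v : tvec R N) : Prop :=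
  (forall c, A c -> dom c p -> exists y : 'rV[R]_m,
     forall F h, smooth_at A p F -> local_expr c p F h ->
       v F = 'D_y h (coord c p)) /\
  (forall F, ~ smooth_at A p F -> v F = 0).

Definition vfield (R : realType) (N : Type) (m : nat)
    (A : set (chart R N m)) (V : N -> tvec R N) : Prop :=
  (forall p, tangent A p (V p)) /\
  (forall p F, smooth_at A p F -> smooth_at A p (fun q => V q F)).

Definition bracket (R : realType) (N : Type) (m : nat)
    (A : set (chart R N m)) (V W : N -> tvec R N) : N -> tvec R N :=
  fun p => on_smooth A p
    (fun F => V p (fun q => W q F) - W p (fun q => V q F)).

(** * Paracompact smooth manifolds *)

Definition paracompact (T : topologicalType) : Prop :=
  forall C : set (set T), (forall U, C U -> open U) ->
    (forall x, exists2 U, C U & U x) ->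
  exists C' : set (set T),
    [/\ forall U, C' U -> open U,
        forall x, exists2 U, C' U & U x,
        forall U, C' U -> exists2 V, C V & U `<=` V &
        forall x : T, exists2 O : set T, nbhs x O &
          finite_set [set U | C' U /\ U `&` O !=set0]].

(* homeomorphism of an open subset of [T] onto an open subset of R^n *)
Definition is_chart (R : realType) (T : topologicalType) (n : nat)
    (c : chart R T n) : Prop :=
  [/\ open (dom c), set_inj (dom c) (coord c),
      forall p, dom c p -> {for p, continuous (coord c)} &
      forall U, open U -> U `<=` dom c -> open (coord c @` U)].

Definition is_manifold (R : realType) (T : topologicalType) (n : nat)
    (A : set (chart R T n)) : Prop :=
  [/\ hausdorff_space T, paracompact T,
      forall p, exists2 c, A c & dom c p,
      forall c, A c -> is_chart c &
      (* smoothness of the transition maps *)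
      forall c, A c -> forall p, dom c p -> forall i : 'I_n,
        smooth_at A p (fun q => coord c q 0 i)].

Record manifold (R : realType) (n : nat) := Manifold {
  carrier :> topologicalType;
  atlas : set (chart R carrier n);
  manifoldP : is_manifold atlas
}.

(** * The slit tangent bundle *)

Definition slit_set (R : realType) (n : nat) (M : manifold R n) :
    set (M * tvec R M) :=
  [set u | tangent (@atlas R n M) u.1 u.2 /\ u.2 <> 0].

Definition slit (R : realType) (n : nat) (M : manifold R n) : Type :=
  set_type (@slit_set R n M).

Section SlitTangentBundle.
Context {R : realType} {n : nat} {M : manifold R n}.

Definition slit_proj (u : slit M) : M := (val u).1.

(* the canonical pi-vector field *)
Definition eta (u : slit M) : tvec R M := (val u).2.

(* coordinates (x^i, y^i) induced by a chart *)
Definition slit_chart (c : chart R M n) : chart R (slit M) (n + n) :=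
  Chart [set u | dom c (slit_proj u)]
    (fun u => row_mx (coord c (slit_proj u))
                     (\row_(i < n) eta u (fun q => coord c q 0 i))).

Definition slit_atlas : set (chart R (slit M) (n + n)) :=
  slit_chart @` (@atlas R n M).

(* elements of the fibre of pi^-1(TM) over u *)
Definition fibre (u : slit M) : set (tvec R M) :=
  [set w | tangent (@atlas R n M) (slit_proj u) w].

Definition pi_vfield (X : slit M -> tvec R M) : Prop :=
  (forall u, fibre u (X u)) /\
  (forall u f, smooth_at (@atlas R n M) (slit_proj u) f ->
     smooth_at slit_atlas u (fun u' => X u' f)).

Definition rho (u : slit M) (v : tvec R (slit M)) : tvec R M :=
  on_smooth (@atlas R n M) (slit_proj u) (fun f => v (f \o slit_proj)).

(* Vertical lift: velocity at t = 0 of the curve t |-> eta u + t w.  The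
   curve lies in the slit bundle for small t; [insub] extends by 0 the
   function t |-> F (eta u + t w) when it does not. *)
Definition gamma (u : slit M) (w : tvec R M) : tvec R (slit M) :=
  on_smooth slit_atlas u
    (fun F => derive1 (fun t : R =>
       oapp F 0 (insub (slit_proj u, eta u + t *: w) : option (slit M))) 0).

(** * Connections on pi^-1(TM) *)

(* [D u v Y] is the derivative at [u] of the pi-vector field [Y] in the
   direction of the vector [v] tangent to the slit bundle at [u]. *)
Definition connection : Type :=
  forall u : slit M, tvec R (slit M) -> (slit M -> tvec R M) -> tvec R M.

Implicit Types (D : connection) (X Y Z : slit M -> tvec R M)
  (V W : slit M -> tvec R (slit M)).

Definition linear_connection D : Prop :=
  [/\ forall u v Y, tangent slit_atlas u v -> pi_vfield Y ->
        fibre u (D u v Y),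
      forall u (a : R) v w Y, tangent slit_atlas u v ->
        tangent slit_atlas u w -> pi_vfield Y ->
        D u (a *: v + w) Y = a *: D u v Y + D u w Y,
      forall u v Y Z, tangent slit_atlas u v -> pi_vfield Y -> pi_vfield Z ->
        D u v (fun u' => Y u' + Z u') = D u v Y + D u v Z,
      forall u v F Y, tangent slit_atlas u v -> smooth slit_atlas F ->
        pi_vfield Y ->
        D u v (fun u' => F u' *: Y u') = v F *: Y u + F u *: D u v Y &
      forall V Y, vfield slit_atlas V -> pi_vfield Y ->
        pi_vfield (fun u => D u (V u) Y)].

Definition cov D V Y : slit M -> tvec R M := fun u => D u (V u) Y.

Definition Kmap D (u : slit M) (v : tvec R (slit M)) : tvec R M := D u v eta.

Definition vertical (u : slit M) : set (tvec R (slit M)) :=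
  [set v | tangent slit_atlas u v /\ rho u v = 0].

Definition horizontal D (u : slit M) : set (tvec R (slit M)) :=
  [set v | tangent slit_atlas u v /\ Kmap D u v = 0].

(* the map beta, inverse of the restriction of rho to the horizontal bundle *)
Definition beta D (u : slit M) (w : tvec R M) : tvec R (slit M) :=
  xget 0 [set v | horizontal D u v /\ rho u v = w].

Definition gammaF X : slit M -> tvec R (slit M) := fun u => gamma u (X u).
Definition betaF D X : slit M -> tvec R (slit M) := fun u => beta D u (X u).
Definition rhoF V : slit M -> tvec R M := fun u => rho u (V u).

(* The direct sum decomposition is one of smooth vector bundles; the last
   clause says that the inverse beta of rho on the horizontal bundle is a
   smooth bundle map. *)
Definition regular D : Prop :=
  [/\ forall u v, tangent slit_atlas u v ->
        exists v1 v2, [/\ vertical u v1, horizontal D u v2 & v = v1 + v2],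
      forall u v, vertical u v -> horizontal D u v -> v = 0 &
      forall X, pi_vfield X -> vfield slit_atlas (betaF D X)].

Definition torsion D V W : slit M -> tvec R M := fun u =>
  cov D V (rhoF W) u - cov D W (rhoF V) u - rho u (bracket slit_atlas V W u).

Definition Qtor D X Y : slit M -> tvec R M :=
  torsion D (betaF D X) (betaF D Y).

Definition Ttor D X Y : slit M -> tvec R M :=
  torsion D (gammaF X) (betaF D Y).

(* (D_V T)(Y, Z) *)
Definition covT D V Y Z : slit M -> tvec R M := fun u =>
  cov D V (Ttor D Y Z) u - Ttor D (cov D V Y) Z u - Ttor D Y (cov D V Z) u.

(** * Finsler manifolds *)

(* g_u(v, w) = (1/2) d^2/dsdt L^2(u + s v + t w) at s = t = 0 *)
Definition finsler_metric (L : M -> tvec R M -> R) (u : slit M)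
    (v w : tvec R M) : R :=
  2^-1 * derive1 (fun s : R =>
    derive1 (fun t : R => L (slit_proj u) (eta u + s *: v + t *: w) ^+ 2) 0) 0.

Definition is_finsler (L : M -> tvec R M -> R) : Prop :=
  [/\ forall u : slit M, 0 < L (slit_proj u) (eta u),
      smooth slit_atlas (fun u => L (slit_proj u) (eta u)),
      forall p v (a : R), tangent (@atlas R n M) p v -> 0 < a ->
        L p (a *: v) = a * L p v &
      forall u v, fibre u v -> v <> 0 -> 0 < finsler_metric L u v v].

Definition metric_connection (g : slit M -> tvec R M -> tvec R M -> R) D :
    Prop :=
  forall V Y Z, vfield slit_atlas V -> pi_vfield Y -> pi_vfield Z ->
    forall u, V u (fun u' => g u' (Y u') (Z u'))
              - g u (cov D V Y u) (Z u) - g u (Y u) (cov D V Z u) = 0.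

Definition cartan_connection (L : M -> tvec R M -> R) D : Prop :=
  let g := finsler_metric L in
  [/\ linear_connection D, regular D, metric_connection g D,
      forall X Y, pi_vfield X -> pi_vfield Y -> forall u, Qtor D X Y u = 0 &
      forall X Y Z, pi_vfield X -> pi_vfield Y -> pi_vfield Z -> forall u,
        g u (Ttor D X Y u) (Z u) = g u (Ttor D X Z u) (Y u)].

(* [berwald] and [Ch_recurrent] are properties of the Finsler manifold whose
   Cartan connection is [D]. *)
Definition berwald D : Prop :=
  forall X Y Z, pi_vfield X -> pi_vfield Y -> pi_vfield Z ->
    forall u, covT D (betaF D X) Y Z u = 0.

Definition pi_one_form (lambda : forall u : slit M, tvec R M -> R) : Prop :=
  (forall u (a : R) v w, fibre u v -> fibre u w ->
     lambda u (a *: v + w) = a * lambda u v + lambda u w) /\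
  (forall X, pi_vfield X -> smooth slit_atlas (fun u => lambda u (X u))).

Definition Ch_recurrent D : Prop :=
  exists2 lambda, pi_one_form lambda &
    forall X Y Z, pi_vfield X -> pi_vfield Y -> pi_vfield Z ->
      forall u, covT D (betaF D X) Y Z u = lambda u (X u) *: Ttor D Y Z u.

(** * Conformal changes *)

Definition conformal (L L' : M -> tvec R M -> R) : Prop :=
  exists sigma : M -> R,
    [/\ smooth (@atlas R n M) sigma, forall p, 0 < sigma p &
        forall u v w, fibre u v -> fibre u w ->
          finsler_metric L' u v w =
          expR (2 * sigma (slit_proj u)) * finsler_metric L u v w].

Definition Bdiff D D' X Y : slit M -> tvec R M := fun u =>
  cov D' (betaF D X) Y u - cov D (betaF D X) Y u.

Definition Nmap D D' X : slit M -> tvec R M := Bdiff D D' X eta.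

Definition Udiff D D' X Y : slit M -> tvec R M := fun u =>
  Bdiff D D' X Y u - cov D (gammaF (Nmap D D' X)) Y u.

Definition Acal D D' X Y Z : slit M -> tvec R M := fun u =>
  Ttor D (Udiff D D' X Y) Z u + Ttor D (Udiff D D' X Z) Y u
  - Udiff D D' X (Ttor D Y Z) u.

End SlitTangentBundle.

Arguments connection {R n} M.

(* Main.v *)
Require Import Defs.
From mathcomp Require Import all_boot all_order all_algebra.
From mathcomp Require Import all_classical all_reals all_analysis.
From mathcomp Require Import ring.

(* With the flat connections of the fibres as a reference, the vertical part of
   the Cartan connection is T: nabla_{gamma X} Y = T(X, Y) + vderiv X Y.
   Metricity and the symmetry axiom give
     2 g(T(X, Y), Z) = gamma X (g(Y, Z)) - g(vderiv X Y, Z) - g(Y, vderiv X Z).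
   A conformal factor that depends on the base point only is constant on the
   fibres, hence T is the same for both structures.  In coordinates the right
   hand side is half the third fibre derivative of L^2, so T is symmetric
   (Schwarz) and T(X, eta) = 0 (Euler, L^2 being homogeneous of degree 2); in
   particular K o gamma = id, which gives beta~ X = beta X - gamma N X and then
   nabla~_{beta~ X} Y = nabla_{beta X} Y + U(beta X, Y).  Therefore
     (nabla~_{beta~ X} T~)(Y, Z) = (nabla_{beta X} T)(Y, Z) - A(X, Y, Z).
   That T(X, Y) and gamma X are smooth requires the slit bundle to be a smooth
   manifold, which comes from the chain rule for the charts of M. *)

Set Implicit Arguments.
Unset Strict Implicit.
Unset Printing Implicit Defensive.

Import Order.TTheory GRing.Theory Num.Theory numFieldNormedType.Exports.
Import Defs.

Local Open Scope classical_set_scope.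
Local Open Scope ring_scope.

(** * Smooth functions on open subsets of R^m *)

Section Calculus.
Context {R : realType}.

Notation pd i f := ('D_(delta_mx 0 i) f).

(** [linear_connection] speaks of globally defined pi-vector fields only, and the proof never
    localises a field or extends a vector to a field; [T] is therefore handled as an operation on
    fields and its tensoriality is never invoked. Two devices replace it. A pi-vector field is shown
    to vanish by pairing it with itself, [g] being positive. Additivity of [T] in the first argument
    comes from linearity of [D] in the direction and of [gamma]; the symmetry of [T] carries it over
    to the second argument. That symmetry has a third use: the Leibniz rule for [T] produces T(Y,
    U(beta X, Z)), whereas A contains T(U(beta X, Z), Y). The flat fibre connections enter through
    the bracket: rho [gamma X, beta Y] is [vderiv X Y], whatever the connection that defines
    [beta]. *)

Lemma open_near (V : topologicalType) (W : set V) (P : V -> Prop) (x : V) :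
  open W -> W x -> (forall y, W y -> P y) -> \forall y \near x, P y.
Proof. by move=> Wo Wx WP; apply: filterS WP _; exact: open_nbhs_nbhs. Qed.

(** The first-order expansion of [f] at [x] is also one of [g], and an expansion with continuous
    linear part determines the differential. *)
Lemma near_eq_differentiable (V W : normedModType R) (f g : V -> W) x :
  (\near x, f x = g x) -> differentiable f x -> differentiable g x.
Proof.
move=> fg /diff_locallyP [dc df].
have e : g \o shift x = cst (g x) + 'd f x +o_ 0 id.
  apply/eqaddoP => _/posnumP[e].
  have /eqaddoP /(_ e%:num [gt0 of e%:num]) := df.
  have fg0 : \forall y \near 0, f (y + x) = g (y + x).
    by move: fg; rewrite (near_shift 0) /=; apply: filterS => y /=; rewrite subr0.
  apply: filterS2 fg0 => y fgy /=.
  by rewrite !fctE /= fgy (nbhs_singleton fg).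
by apply/diff_locallyP; rewrite (diff_unique dc e).
Qed.

Lemma derive_eq_on (V : normedModType R) (W : set V) (f g : V -> R) v x :
  open W -> W x -> (forall y, W y -> f y = g y) -> 'D_v f x = 'D_v g x.
Proof. by move=> Wo Wx fg; apply: near_eq_derive; exact: open_near fg. Qed.

Lemma derive_sumE (m : nat) (f : 'rV[R]_m -> R) (v x : 'rV[R]_m) :
  differentiable f x -> 'D_v f x = \sum_i v 0 i * pd i f x.
Proof.
move=> df; rewrite deriveE // [in LHS](row_sum_delta v) linear_sum /=.
apply: eq_bigr => i _; rewrite linearZ /=; by rewrite -deriveE.
Qed.

Lemma derive_linear (m : nat) (f : 'rV[R]_m -> R) a (v w x : 'rV[R]_m) :
  differentiable f x -> 'D_(a *: v + w) f x = a * 'D_v f x + 'D_w f x.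
Proof. by move=> df; rewrite !deriveE // linearP. Qed.

Lemma derive_coord (m : nat) (v x : 'rV[R]_m) i :
  'D_v (fun y : 'rV[R]_m => y 0 i) x = v 0 i.
Proof.
have did : derivable (id : 'rV[R]_m -> 'rV[R]_m) x v by exact: derivable_id.
have := derive_mx did; rewrite derive_id => /matrixP /(_ 0 i).
by rewrite !mxE => ->.
Qed.

Lemma differentiable_row (V : normedModType R) (k : nat)
    (Phi : V -> 'rV[R]_k) (x : V) :
  (forall j, differentiable (fun y => Phi y 0 j) x) -> differentiable Phi x.
Proof.
move=> dPhi.
have -> : Phi = \sum_(j < k) (fun y => Phi y 0 j *: (delta_mx 0 j : 'rV[R]_k)).
  by apply/funext => y; rewrite fct_sumE [LHS]row_sum_delta.
by apply: differentiable_sum => j; exact: differentiableZl.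
Qed.

Lemma derive_comp_row (V : normedModType R) (k : nat) (h : 'rV[R]_k -> R)
    (Phi : V -> 'rV[R]_k) (x v : V) :
  (forall j, differentiable (fun y => Phi y 0 j) x) ->
  differentiable h (Phi x) ->
  'D_v (fun y => h (Phi y)) x =
  \sum_j 'D_v (fun y => Phi y 0 j) x * pd j h (Phi x).
Proof.
move=> dPhi dh; have dP := differentiable_row dPhi.
rewrite deriveE; last exact: differentiable_comp.
rewrite [X in 'd X x](_ : _ = h \o Phi) // diff_comp //= -deriveE //.
rewrite derive_sumE //; apply: eq_bigr => j _.
rewrite -deriveE // derive_mx ?mxE //; exact: diff_derivable.
Qed.

Lemma is_derive_line (m : nat) (h : 'rV[R]_m -> R) (a v : 'rV[R]_m) (t : R) :
  differentiable h (a + t *: v) ->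
  is_derive t (1 : R) (fun t => h (a + t *: v)) ('D_v h (a + t *: v)).
Proof.
move=> dh.
have dq : (fun r : R => r^-1 *: (((fun t => h (a + t *: v)) \o shift t) (r *: 1)
    - h (a + t *: v))) =
    (fun r : R => r^-1 *: ((h \o shift (a + t *: v)) (r *: v)
    - h (a + t *: v))).
  apply/funext => r /=; congr (_ *: (h _ - _)).
  by rewrite [r%:A]mulr1 scalerDl addrCA.
apply: DeriveDef; last by rewrite /derive dq.
by rewrite /derivable dq; exact: diff_derivable.
Qed.

Lemma is_derive_line0 (m : nat) (h : 'rV[R]_m -> R) (a v : 'rV[R]_m) :
  differentiable h a ->
  is_derive (0 : R) (1 : R) (fun t => h (a + t *: v)) ('D_v h a).
Proof.
move=> dh; have := @is_derive_line _ h a v 0.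
by rewrite scale0r addr0; exact.
Qed.

Section SmoothOn.
Context {m : nat}.
Implicit Types (W : set 'rV[R]_m) (f g : 'rV[R]_m -> R).

Lemma smooth_on_differentiable W f x :
  smooth_on W f -> W x -> differentiable f x.
Proof. by move=> sf Wx; exact: (sf [::]). Qed.

Lemma smooth_on_partial W f i : smooth_on W f -> smooth_on W (pd i f).
Proof.
move=> sf s x Wx; move: (sf (rcons s i) x Wx).
by rewrite /iter_partial foldr_rcons.
Qed.

Lemma smooth_on_sub W W' f : W' `<=` W -> smooth_on W f -> smooth_on W' f.
Proof. by move=> sWW sf s x /sWW; exact: sf. Qed.

Lemma iter_partial_eq_on W f g : open W -> (forall x, W x -> f x = g x) ->
  forall s x, W x -> iter_partial s f x = iter_partial s g x.
Proof.
move=> Wo fg; elim=> [|i s IH] x Wx /=; first exact: fg.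
exact: (derive_eq_on _ Wo Wx IH).
Qed.

(* Coinduction: a class of differentiable functions that is stable under
   partial derivatives consists of smooth functions. *)
Lemma smooth_on_coind W (P : ('rV[R]_m -> R) -> Prop) : open W ->
  (forall f, P f -> forall x, W x -> differentiable f x) ->
  (forall f i, P f -> exists2 g, P g & forall x, W x -> pd i f x = g x) ->
  forall f, P f -> smooth_on W f.
Proof.
move=> Wo Pd Pp f Pf s; elim/last_ind: s f Pf => [|s i IH] f Pf x Wx.
  exact: Pd.
have [g Pg fg] := Pp f i Pf.
(* The last index of the list is differentiated first, hence the induction from the end of [s]: on
   [W] the derivative [pd i f] may be replaced by [g], which is again in the class. *)
rewrite /iter_partial foldr_rcons; apply: near_eq_differentiable (IH g Pg x Wx).
by apply: (open_near Wo Wx) => y Wy; apply/esym/(iter_partial_eq_on Wo fg).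
Qed.

End SmoothOn.

Section SmoothClosure.
Context {m : nat}.
Implicit Types (W : set 'rV[R]_m) (f g : 'rV[R]_m -> R).

(* The closure of the smooth functions under the algebra operations and
   composition is stable under partial derivatives, by the Leibniz and chain
   rules. *)
Inductive smooth_closure W : ('rV[R]_m -> R) -> Prop :=
| smooth_closure_gen f : smooth_on W f -> smooth_closure W f
| smooth_closure_cst c : smooth_closure W (fun=> c)
| smooth_closure_coord i : smooth_closure W (fun x => x 0 i)
| smooth_closureD f g : smooth_closure W f -> smooth_closure W g ->
    smooth_closure W (fun x => f x + g x)
| smooth_closureM f g : smooth_closure W f -> smooth_closure W g ->
    smooth_closure W (fun x => f x * g x)
| smooth_closure_comp k (U : set 'rV[R]_k) h (Phi : 'rV[R]_m -> 'rV[R]_k) :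
    smooth_on U h -> (forall x, W x -> U (Phi x)) ->
    (forall j, smooth_closure W (fun x => Phi x 0 j)) ->
    smooth_closure W (fun x => h (Phi x)).

Lemma smooth_closure_differentiable W f : smooth_closure W f ->
  forall x, W x -> differentiable f x.
Proof.
elim=> {f} [f sf|c|i|f g _ df _ dg|f g _ df _ dg|k U h Phi sh WU _ dPhi] x Wx.
- exact: smooth_on_differentiable Wx.
- exact: differentiable_cst.
- exact: differentiable_coord.
- exact: differentiableD (df _ Wx) (dg _ Wx).
- exact: differentiableM (df _ Wx) (dg _ Wx).
- have dP : differentiable Phi x by apply: differentiable_row => j; exact: dPhi.
  have dh := smooth_on_differentiable sh (WU _ Wx).
  exact: differentiable_comp dP dh.
Qed.

Lemma smooth_closure_sum W k (F : 'I_k -> 'rV[R]_m -> R) :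
  (forall j, smooth_closure W (F j)) ->
  smooth_closure W (fun x => \sum_j F j x).
Proof.
move=> sF; have -> : (fun x => \sum_j F j x) = \sum_j F j.
  by apply/funext => x; rewrite fct_sumE.
elim/big_ind: _ => [|f g sf sg|j _]; last exact: sF.
  exact: smooth_closure_cst.
exact: smooth_closureD.
Qed.

Lemma smooth_closure_partial W f i : smooth_closure W f ->
  exists2 g, smooth_closure W g & forall x, W x -> pd i f x = g x.
Proof.
elim=> {f} [f sf|c|j|f f' sf [g sg fg] sf' [g' sg' fg']
           |f f' sf [g sg fg] sf' [g' sg' fg']|k U h Phi sh WU sPhi IH].
- by exists (pd i f) => //; exact/smooth_closure_gen/smooth_on_partial.
- by exists (fun=> 0); [exact: smooth_closure_cst|move=> x _; exact: derive_cst].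
- exists (fun=> (delta_mx 0 i : 'rV[R]_m) 0 j); first exact: smooth_closure_cst.
  by move=> x _; exact: derive_coord.
- exists (fun x => g x + g' x); first exact: smooth_closureD.
  move=> x Wx; rewrite -fg // -fg' //; apply: deriveD; apply: diff_derivable.
    exact: (smooth_closure_differentiable sf).
  exact: (smooth_closure_differentiable sf').
- exists (fun x => f x * g' x + f' x * g x).
    by apply: smooth_closureD; exact: smooth_closureM.
  move=> x Wx; rewrite -fg // -fg' //; apply: deriveM; apply: diff_derivable.
    exact: (smooth_closure_differentiable sf).
  exact: (smooth_closure_differentiable sf').
- pose dPhi j := sval (cid2 (IH j)).
  have sdPhi j : smooth_closure W (dPhi j) by rewrite /dPhi; case: cid2.
  have dPhiE j x : W x -> pd i (fun y => Phi y 0 j) x = dPhi j x.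
    by rewrite /dPhi; case: cid2 => g /= _; exact.
  exists (fun x => \sum_j dPhi j x * pd j h (Phi x)).
    apply: smooth_closure_sum => j; apply: smooth_closureM => //.
    by apply: (smooth_closure_comp (smooth_on_partial _ sh)).
  move=> x Wx; rewrite derive_comp_row.
  + by apply: eq_bigr => j _; rewrite dPhiE.
  + by move=> j; exact: (smooth_closure_differentiable (sPhi j)).
  + exact: (smooth_on_differentiable sh (WU _ Wx)).
Qed.

Lemma smooth_closure_smooth W f : open W -> smooth_closure W f -> smooth_on W f.
Proof.
move=> Wo; apply: smooth_on_coind => // [g|g i].
  exact: smooth_closure_differentiable.
exact: smooth_closure_partial.
Qed.

Lemma smooth_on_cst W c : open W -> smooth_on W (fun=> c).
Proof. by move=> Wo; exact/smooth_closure_smooth/smooth_closure_cst. Qed.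

Lemma smooth_on_coord W i : open W -> smooth_on W (fun x => x 0 i).
Proof. by move=> Wo; exact/smooth_closure_smooth/smooth_closure_coord. Qed.

Lemma smooth_onD W f g : open W -> smooth_on W f -> smooth_on W g ->
  smooth_on W (fun x => f x + g x).
Proof.
move=> Wo sf sg; apply: smooth_closure_smooth => //.
by apply: smooth_closureD; exact: smooth_closure_gen.
Qed.

Lemma smooth_onM W f g : open W -> smooth_on W f -> smooth_on W g ->
  smooth_on W (fun x => f x * g x).
Proof.
move=> Wo sf sg; apply: smooth_closure_smooth => //.
by apply: smooth_closureM; exact: smooth_closure_gen.
Qed.

Lemma smooth_on_sum W k (F : 'I_k -> 'rV[R]_m -> R) : open W ->
  (forall j, smooth_on W (F j)) -> smooth_on W (fun x => \sum_j F j x).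
Proof.
move=> Wo sF; apply: smooth_closure_smooth => //.
by apply: smooth_closure_sum => j; exact: smooth_closure_gen.
Qed.

Lemma smooth_on_comp W k (U : set 'rV[R]_k) h (Phi : 'rV[R]_m -> 'rV[R]_k) :
  open W -> smooth_on U h -> (forall x, W x -> U (Phi x)) ->
  (forall j, smooth_on W (fun x => Phi x 0 j)) ->
  smooth_on W (fun x => h (Phi x)).
Proof.
move=> Wo sh WU sPhi; apply: smooth_closure_smooth => //.
by apply: (smooth_closure_comp sh) => // j; exact: smooth_closure_gen.
Qed.

End SmoothClosure.

Lemma open_preimage_row (k m : nat) (W : set 'rV[R]_m) (U : set 'rV[R]_k)
    (Phi : 'rV[R]_m -> 'rV[R]_k) :
  open W -> open U -> (forall j, smooth_on W (fun x => Phi x 0 j)) ->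
  open [set x | W x /\ U (Phi x)].
Proof.
move=> Wo Uo sPhi; rewrite openE => x [Wx Ux] /=.
have cPhi : {for x, continuous Phi}.
  apply: differentiable_continuous; apply: differentiable_row => j.
  exact: smooth_on_differentiable (sPhi j) Wx.
apply: filterS2 (open_nbhs_nbhs (conj Wo Wx))
  (cPhi _ (open_nbhs_nbhs (conj Uo Ux))) => y.
by split.
Qed.

(** * Symmetry of second partial derivatives *)

Lemma line_MVT (m : nat) (h : 'rV[R]_m -> R) (a v : 'rV[R]_m) (s : R) :
  0 < s -> (forall t : R, 0 <= t <= s -> differentiable h (a + t *: v)) ->
  exists2 t : R, 0 <= t <= s & h (a + s *: v) - h a = 'D_v h (a + t *: v) * s.
Proof.
move=> s0 dh.
have [||t] := @MVT R (fun t => h (a + t *: v))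
  (fun t => 'D_v h (a + t *: v)) 0 s s0.
- move=> t; rewrite in_itv /= => /andP [t0 ts].
  by apply/is_derive_line/dh; rewrite !ltW.
- apply: derivable_within_continuous => t; rewrite in_itv /= => ts.
  by have [] := is_derive_line (dh t ts).
- rewrite in_itv /= => /andP [t0 ts]; rewrite scale0r addr0 subr0 => E.
  by exists t => //; rewrite !ltW.
Qed.

(* Two applications of the mean value theorem to the second difference of [f]. *)
Lemma second_difference (m : nat) (W : set 'rV[R]_m)
    (f : 'rV[R]_m -> R) (x v w : 'rV[R]_m) (s : R) :
  (forall y, W y -> differentiable f y) ->
  (forall y, W y -> differentiable ('D_v f) y) -> 0 < s ->
  (forall a b : R, 0 <= a <= s -> 0 <= b <= s -> W (x + a *: v + b *: w)) ->
  exists a b : R, [/\ 0 <= a <= s, 0 <= b <= s &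
    f (x + s *: v + s *: w) - f (x + s *: v) - (f (x + s *: w) - f x) =
    'D_w ('D_v f) (x + a *: v + b *: w) * s * s].
Proof.
move=> df ddf s0 Ws.
have s00 : (0 : R) <= 0 <= s by rewrite !lexx ltW.
have sss : 0 <= s <= s by rewrite !lexx ltW.
have Wv a : 0 <= a <= s -> W (x + a *: v).
  by move=> as0; have := Ws a 0 as0 s00; rewrite scale0r addr0.
pose phi y := f (s *: w + y) - f y.
have dphi a : 0 <= a <= s -> is_derive a (1 : R) (fun t => phi (x + t *: v))
    ('D_v f (x + a *: v + s *: w) - 'D_v f (x + a *: v)).
  move=> as0; apply: is_deriveB; last exact/is_derive_line/df/Wv.
  have := @is_derive_line _ f (s *: w + x) v a.
  rewrite (_ : s *: w + x + a *: v = x + a *: v + s *: w); last first.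
    by rewrite [s *: w + x]addrC addrAC.
  move=> /(_ (df _ (Ws _ _ as0 sss))).
  by under eq_fun do rewrite -addrA.
have [||a] := @MVT R (fun t => phi (x + t *: v))
  (fun a => 'D_v f (x + a *: v + s *: w) - 'D_v f (x + a *: v)) 0 s s0.
- move=> t; rewrite in_itv /= => /andP [t0 ts].
  by apply: dphi; rewrite !ltW.
- apply: derivable_within_continuous => t; rewrite in_itv /= => ts.
  by have [] := dphi t ts.
rewrite in_itv /= => /andP [a0 as_]; rewrite scale0r addr0 subr0 => E.
have as0 : 0 <= a <= s by rewrite !ltW.
have [|b bs E2] := @line_MVT _ ('D_v f) (x + a *: v) w s s0.
  by move=> t ts; exact/ddf/Ws.
exists a, b; split => //.
by rewrite -E2 -E /phi ![s *: w + _]addrC.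
Qed.

Lemma near_small_box (m : nat) (x v w : 'rV[R]_m) (P : set 'rV[R]_m) :
  (\forall y \near x, P y) ->
  exists2 s : R, 0 < s & forall a b : R, 0 <= a <= s -> 0 <= b <= s ->
    P (x + a *: v + b *: w).
Proof.
move=> /nbhs_ballP [e /= e0 Pe].
have K0 : 0 < `|v| + `|w| + 1.
  by rewrite ltr_wpDl // addr_ge0.
(* With this bound the displacement has norm at most e / 2; the added 1 keeps the denominator
   positive when [v] and [w] are both 0. *)
exists (e / 2 / (`|v| + `|w| + 1)); first by rewrite !divr_gt0.
set s := _ / _; move=> a b /andP[a0 as_] /andP[b0 bs]; apply: Pe.
rewrite -ball_normE /= opprD opprD addrA addrA subrr add0r -opprD normrN.
apply: le_lt_trans (ler_normD _ _) _; rewrite !normrZ !ger0_norm //.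
have : a * `|v| + b * `|w| <= s * (`|v| + `|w| + 1).
  rewrite !mulrDr mulr1 ler_wpDr ?(le_trans a0) //.
  by apply: lerD; rewrite ler_wpM2r.
move=> /le_lt_trans; apply.
by rewrite /s divfK ?gt_eqF // ltr_pdivrMr // ltr_pMr // ltr1n.
Qed.

Lemma dist_le_half_half (e p q r r' : R) :
  r = r' -> `|p - r'| < e / 2 -> `|q - r| < e / 2 -> `|p - q| <= e.
Proof.
move=> -> pr qr; rewrite (splitr e) -(subrKA r').
by rewrite (le_trans (ler_normD _ _)) // lerD // ?[`|r' - q|]distrC ltW.
Qed.

(** The second difference of [f] over a square of side [s] is symmetric in [v] and [w]. It equals
    s^2 times a value of either mixed derivative near [x], and both are continuous at [x]. *)
Theorem schwarz (m : nat) (W : set 'rV[R]_m) (f : 'rV[R]_m -> R) i j (x : 'rV[R]_m) :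
  open W -> smooth_on W f -> W x -> pd i (pd j f) x = pd j (pd i f) x.
Proof.
move=> Wo sf Wx; apply/eqP; rewrite -subr_eq0 -normr_le0.
apply/ler_addgt0Pr => e e0; rewrite add0r.
set v := delta_mx 0 i; set w := delta_mx 0 j.
have cont k l : {for x, continuous (pd k (pd l f))}.
  apply/differentiable_continuous/(smooth_on_differentiable _ Wx).
  by do 2!apply: smooth_on_partial.
have e2 : 0 < e / 2 by rewrite divr_gt0.
have /cvgrPdist_lt/(_ _ e2) n1 := cont i j.
have /cvgrPdist_lt/(_ _ e2) n2 := cont j i.
have [s s0 box] := near_small_box v w
  (filterI (open_nbhs_nbhs (conj Wo Wx)) (filterI n1 n2)).
have boxW a b : 0 <= a <= s -> 0 <= b <= s -> W (x + a *: v + b *: w).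
  by move=> as0 bs0; have [] := box a b as0 bs0.
have df y : W y -> differentiable f y by exact: smooth_on_differentiable.
have ddf k y : W y -> differentiable (pd k f) y.
  by apply: smooth_on_differentiable; exact: smooth_on_partial.
have [a [b [as0 bs0 E1]]] := second_difference df (ddf i) s0 boxW.
have [|b' [a' [bs0' as0' E2]]] := @second_difference _ W f x w v s df (ddf j) s0.
  by move=> b' a' ? ?; rewrite addrAC; exact: boxW.
have [_ [_ {}n2]] := box a b as0 bs0.
have [_ [{}n1 _]] := box a' b' as0' bs0'.
have E : pd j (pd i f) (x + a *: v + b *: w) = pd i (pd j f) (x + a' *: v + b' *: w).
  have sn0 : s != 0 by rewrite gt_eqF.
  apply: (mulIf sn0); apply: (mulIf sn0).
  apply: etrans (esym E1) _; rewrite (addrAC x (a' *: v)).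
  by apply: etrans _ E2; rewrite (addrAC x (s *: w)); ring.
exact: dist_le_half_half E n1 n2.
Qed.

End Calculus.

(** * Tangent vectors and charts *)

Lemma open_forall (T : topologicalType) (I : finType) (W : I -> set T) :
  (forall i, open (W i)) -> open [set x | forall i, W i x].
Proof.
move=> Wo; rewrite openE => x Wx; apply: filter_forall => i.
exact: (open_nbhs_nbhs (conj (Wo i) (Wx i))).
Qed.

Section Atlas.
Context {R : realType} {N : Type} {m : nat}.
Implicit Types (A : set (chart R N m)) (c d : chart R N m) (p q : N).

(* No topology on [N] is needed (the slit bundle carries none): domains are
   only required to be open in the coordinates. *)
Definition compatible A : Prop :=
  [/\ forall p, exists2 c, A c & dom c p,
      forall c, A c -> open (coord c @` dom c) &
      forall c d p, A c -> A d -> dom c p -> dom d p ->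
      exists (W : set 'rV[R]_m) (Phi : 'rV[R]_m -> 'rV[R]_m),
        [/\ open W, W (coord d p), forall j, smooth_on W (fun x => Phi x 0 j) &
            forall q, dom d q -> W (coord d q) ->
              dom c q /\ coord c q = Phi (coord d q)]].

Definition vcoord c (v : tvec R N) : 'rV[R]_m :=
  \row_i v (fun q => coord c q 0 i).

Lemma vcoordP c a (v w : tvec R N) :
  vcoord c (a *: v + w) = a *: vcoord c v + vcoord c w.
Proof. by apply/rowP => i; rewrite !mxE. Qed.

Lemma vcoord0 c : vcoord c 0 = 0.
Proof. by apply/rowP => i; rewrite !mxE. Qed.

Lemma local_expr_sub c p (W : set 'rV[R]_m) F G h : open W -> W (coord c p) ->
  (forall q, dom c q -> W (coord c q) -> F q = G q) ->
  local_expr c p F h -> local_expr c p G h.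
Proof.
move=> Wo Wp FG [U [Uo Up sh Fh]]; exists (W `&` U); split.
- exact: openI.
- by split.
- by apply: smooth_on_sub sh => x [].
- by move=> q cq [Wq Uq]; rewrite -FG // Fh.
Qed.

Lemma local_expr_differentiable c p F h :
  local_expr c p F h -> differentiable h (coord c p).
Proof. by move=> [W [Wo Wp sh _]]; exact: smooth_on_differentiable Wp. Qed.

Lemma local_expr_val c p F h : dom c p -> local_expr c p F h ->
  F p = h (coord c p).
Proof. by move=> cp [W [Wo Wp sh ->]]. Qed.

Lemma local_expr_cst c p r : local_expr c p (fun=> r) (fun=> r).
Proof.
by exists setT; split=> //; [exact: openT|exact/smooth_on_cst/openT].
Qed.

Lemma local_expr_coord c p i :
  local_expr c p (fun q => coord c q 0 i) (fun x => x 0 i).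
Proof.
by exists setT; split=> //; [exact: openT|exact/smooth_on_coord/openT].
Qed.

Lemma local_exprD c p F G h k : local_expr c p F h -> local_expr c p G k ->
  local_expr c p (fun q => F q + G q) (fun x => h x + k x).
Proof.
move=> [W [Wo Wp sh Fh]] [U [Uo Up sk Gk]]; exists (W `&` U).
have WUo : open (W `&` U) by exact: openI.
split=> //; last by move=> q cq [Wq Uq]; rewrite Fh // Gk.
by apply: smooth_onD => //; apply: smooth_on_sub; try eassumption; move=> x [].
Qed.

Lemma local_exprM c p F G h k : local_expr c p F h -> local_expr c p G k ->
  local_expr c p (fun q => F q * G q) (fun x => h x * k x).
Proof.
move=> [W [Wo Wp sh Fh]] [U [Uo Up sk Gk]]; exists (W `&` U).
have WUo : open (W `&` U) by exact: openI.
split=> //; last by move=> q cq [Wq Uq]; rewrite Fh // Gk.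
by apply: smooth_onM => //; apply: smooth_on_sub; try eassumption; move=> x [].
Qed.

Lemma local_expr_sum c p k (F : 'I_k -> N -> R) h :
  (forall j, local_expr c p (F j) (h j)) ->
  local_expr c p (fun q => \sum_j F j q) (fun x => \sum_j h j x).
Proof.
move=> Fh; have -> : (fun q => \sum_j F j q) = \sum_j F j.
  by apply/funext => x; rewrite fct_sumE.
have -> : (fun x => \sum_j h j x) = \sum_j h j.
  by apply/funext => x; rewrite fct_sumE.
apply: (big_ind2 (fun F h => local_expr c p F h)) => [|f1 h1 f2 h2 l1 l2|j _];
  last exact: Fh.
  exact: local_expr_cst.
exact: local_exprD.
Qed.

Section Compatible.
Variable A : set (chart R N m).
Hypothesis compA : compatible A.

Lemma local_expr_transition c d p F h : A c -> A d -> dom c p -> dom d p ->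
  local_expr c p F h ->
  exists2 Phi : 'rV[R]_m -> 'rV[R]_m,
    forall j, local_expr d p (fun q => coord c q 0 j) (fun x => Phi x 0 j) &
    local_expr d p F (fun x => h (Phi x)).
Proof.
move=> Ac Ad cp dp [U [Uo Up sh Fh]].
have [_ _ tr] := compA; have [W [Phi [Wo Wp sPhi PhiE]]] := tr _ _ _ Ac Ad cp dp.
exists Phi.
  by move=> j; exists W; split => // q dq Wq; have [_ ->] := PhiE q dq Wq.
have W'o := open_preimage_row Wo Uo sPhi.
exists [set x | W x /\ U (Phi x)]; split => //.
- by split => //; have [_ <-] := PhiE p dp Wp.
- apply: (smooth_on_comp W'o sh) => [x []//|j].
  by apply: smooth_on_sub (sPhi j) => x [].
- move=> q dq [Wq Uq]; have [cq E] := PhiE q dq Wq.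
  by rewrite Fh ?E.
Qed.

Lemma local_expr_smooth_at c p F h : A c -> dom c p -> local_expr c p F h ->
  smooth_at A p F.
Proof.
move=> Ac cp Fh d Ad dp.
by have [Phi _ ?] := local_expr_transition Ac Ad cp dp Fh; exists (fun x => h (Phi x)).
Qed.

Lemma smooth_at_coord c p i : A c -> dom c p ->
  smooth_at A p (fun q => coord c q 0 i).
Proof. by move=> Ac cp; exact: local_expr_smooth_at (local_expr_coord c p i). Qed.

Lemma smooth_at_near c p F h : A c -> local_expr c p F h ->
  exists W : set 'rV[R]_m, [/\ open W, W (coord c p), smooth_on W h &
    forall q, dom c q -> W (coord c q) ->
      [/\ F q = h (coord c q), smooth_at A q F & local_expr c q F h]].
Proof.
move=> Ac [W [Wo Wp sh Fh]]; exists W; split => // q cq Wq.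
have lq : local_expr c q F h by exists W.
by split; [exact: Fh|exact: local_expr_smooth_at lq|].
Qed.

(** Local expressions of [F] are determined on the image of the chart only; this image is open, so
    their derivatives at [coord c p] agree. *)
Lemma local_expr_derive c p F h k y : A c -> dom c p ->
  local_expr c p F h -> local_expr c p F k ->
  'D_y h (coord c p) = 'D_y k (coord c p).
Proof.
move=> Ac cp [W [Wo Wp sh Fh]] [U [Uo Up sk Fk]].
have [_ /(_ c Ac) imo _] := compA.
apply: (@derive_eq_on _ _ (W `&` U `&` (coord c @` dom c))).
- by do 2?apply: openI.
- by split => //; exists p.
- by move=> x [[Wx Ux] [q cq qx]]; subst x; rewrite -Fh ?Fk.
Qed.

(** The tangent vector with components [y] in [c]. By [local_expr_derive] its value does not depend
    on the local expression that [xget] picks. *)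
Definition chart_vector c p (y : 'rV[R]_m) : tvec R N :=
  on_smooth A p (fun F => 'D_y (xget 0 [set h | local_expr c p F h]) (coord c p)).

Lemma chart_vectorE c p y F h : A c -> dom c p -> local_expr c p F h ->
  chart_vector c p y F = 'D_y h (coord c p).
Proof.
move=> Ac cp Fh; rewrite /chart_vector /on_smooth.
rewrite asboolT; last exact: local_expr_smooth_at Fh.
by apply: (local_expr_derive _ Ac cp _ Fh); case: xgetP => // /(_ h).
Qed.

Lemma chart_vector_tangent c p y : A c -> dom c p ->
  tangent A p (chart_vector c p y).
Proof.
move=> Ac cp; split; last first.
  by move=> F nF; rewrite /chart_vector /on_smooth asboolF.
move=> d Ad dp.
have [_ _ tr] := compA.
have [W [Phi [Wo Wp sPhi PhiE]]] := tr d c p Ad Ac dp cp.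
(* The components in [d] are the Jacobian of the transition map applied to [y]. *)
exists (\row_j 'D_y (fun x => Phi x 0 j) (coord c p)) => F h sF Fh.
have W'o V : open V -> open [set x | W x /\ V (Phi x)].
  by move=> Vo; exact: open_preimage_row.
have [U [Uo Up sh Fh']] := Fh.
have Phip : Phi (coord c p) = coord d p by have [_ <-] := PhiE p cp Wp.
rewrite (@chart_vectorE _ _ _ _ (fun x => h (Phi x))) //; last first.
  exists [set x | W x /\ U (Phi x)]; split => //.
  - exact: W'o.
  - by split => //; rewrite Phip.
  - apply: (smooth_on_comp (W'o _ Uo) sh) => [x []//|j].
    by apply: smooth_on_sub (sPhi j) => x [].
  - by move=> q cq [Wq Uq]; have [dq E] := PhiE q cq Wq; rewrite Fh' ?E.
rewrite [LHS]derive_comp_row.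
- rewrite [RHS]derive_sumE; last exact: local_expr_differentiable Fh.
  by rewrite Phip; apply: eq_bigr => j _; rewrite mxE.
- by move=> j; exact: smooth_on_differentiable (sPhi j) Wp.
- by rewrite Phip; exact: local_expr_differentiable Fh.
Qed.

Lemma vcoord_chart_vector c p y : A c -> dom c p ->
  vcoord c (chart_vector c p y) = y.
Proof.
move=> Ac cp; apply/rowP => i; rewrite mxE.
rewrite (chart_vectorE _ Ac cp (local_expr_coord c p i)).
exact: derive_coord.
Qed.

Lemma tangent_linear p a (v w : tvec R N) : tangent A p v -> tangent A p w ->
  tangent A p (a *: v + w).
Proof.
move=> [vc v0] [wc w0]; split; last first.
  by move=> F nF; rewrite !fctE v0 // w0 // addr0 scaler0.
move=> c Ac cp; have [y vE] := vc c Ac cp; have [z wE] := wc c Ac cp.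
exists (a *: y + z) => F h sF Fh.
rewrite derive_linear; last exact: local_expr_differentiable Fh.
by rewrite -(vE F h) // -(wE F h).
Qed.

Lemma tangent0 p : tangent A p 0.
Proof.
split => // c Ac cp; exists 0 => F h sF Fh.
by rewrite derive0.
Qed.

Lemma tangentZ p a (v : tvec R N) : tangent A p v -> tangent A p (a *: v).
Proof.
by move=> tv; have := tangent_linear a tv (tangent0 p); rewrite addr0.
Qed.

Lemma tangentD p (v w : tvec R N) : tangent A p v -> tangent A p w ->
  tangent A p (v + w).
Proof. by move=> tv /(tangent_linear 1 tv); rewrite scale1r. Qed.

Lemma tangentB p (v w : tvec R N) : tangent A p v -> tangent A p w ->
  tangent A p (v - w).
Proof.
by move=> tv tw; have := tangent_linear (-1) tw tv; rewrite scaleN1r addrC.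
Qed.

(** Testing [v] on the coordinate functions identifies the anonymous vector [y] of [tangent] with
    [vcoord c v]. *)
Lemma tangentE c p v F h : A c -> dom c p -> tangent A p v ->
  local_expr c p F h -> v F = 'D_(vcoord c v) h (coord c p).
Proof.
move=> Ac cp [vc _] Fh; have [y vE] := vc c Ac cp.
rewrite (vE F h) //; last exact: local_expr_smooth_at Fh.
congr ('D_ _ _ _); apply/rowP => i; rewrite mxE.
rewrite (vE _ _ (smooth_at_coord i Ac cp) (local_expr_coord c p i)).
by rewrite derive_coord.
Qed.

Lemma tangent_eq c p (v w : tvec R N) : A c -> dom c p ->
  tangent A p v -> tangent A p w -> vcoord c v = vcoord c w -> v = w.
Proof.
move=> Ac cp tv tw E; apply/funext => F.
have [sF|nF] := pselect (smooth_at A p F); last first.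
  by case: tv tw => _ -> // [_ ->].
have [h Fh] := sF c Ac cp.
by rewrite (tangentE Ac cp tv Fh) (tangentE Ac cp tw Fh) E.
Qed.

(* A field of tangent vectors is smooth as soon as its components are, since
   a function that is smooth at [p] is smooth near [p]. *)
Lemma tangent_field_local_expr c p (V : N -> tvec R N) F h
    (Vc : 'I_m -> 'rV[R]_m -> R) :
  A c -> dom c p -> (forall q, tangent A q (V q)) ->
  (forall i, local_expr c p (fun q => V q (fun q' => coord c q' 0 i)) (Vc i)) ->
  local_expr c p F h ->
  local_expr c p (fun q => V q F)
    (fun x => \sum_i Vc i x * 'D_(delta_mx 0 i) h x).
Proof.
move=> Ac cp tV VcE Fh; have [W [Wo Wp sh near]] := smooth_at_near Ac Fh.
apply: (@local_expr_sub _ _ W (fun q => \sum_i V q (fun q' => coord c q' 0 i) *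
  'D_(delta_mx 0 i) h (coord c q))) => //.
  move=> q cq Wq; have [_ sq lq] := near q cq Wq.
  rewrite (tangentE Ac cq (tV q) lq) derive_sumE.
    by apply: eq_bigr => i _; rewrite mxE.
  exact: local_expr_differentiable lq.
apply: local_expr_sum => i; apply: local_exprM => //.
by exists W; split => //; exact: smooth_on_partial.
Qed.

End Compatible.
End Atlas.

(** * The slit bundle as a manifold *)

Lemma derive_lsubmx (R : realType) (k l : nat) (h : 'rV[R]_k -> R)
    (w z : 'rV[R]_(k + l)) :
  'D_w (fun x : 'rV[R]_(k + l) => h (lsubmx x)) z = 'D_(lsubmx w) h (lsubmx z).
Proof.
rewrite /derive; set F := fun t => _; set G := fun t => _.
suff -> : F = G by [].
by apply/funext => t; rewrite /F /G /= linearP.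
Qed.

Lemma near_line (R : realType) (k : nat) (x v : 'rV[R]_k) (P : set 'rV[R]_k) :
  (\forall y \near x, P y) -> \forall t \near (0 : R), P (x + t *: v).
Proof.
have : (fun t : R => x + t *: v) @ (0 : R) --> x + 0 *: v.
  by apply: cvgD; [exact: cvg_cst|exact: scalel_continuous].
by rewrite scale0r addr0; exact.
Qed.

Section SlitBundle.
Context {R : realType} {n : nat} {M : manifold R n}.

Notation AM := (@atlas R n M).
Notation SA := (@slit_atlas R n M).
Implicit Types (c d : chart R M n) (p : M) (u : slit M).

Lemma manifold_compatible : compatible AM.
Proof.
have [_ _ cover charts trans] := @manifoldP R n M; split=> //.
  by move=> c Ac; have [co _ _ open_im] := charts c Ac; exact: open_im.
move=> c d p Ac Ad cp dp.
have /choice[h hE] : forall i, exists h,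
    local_expr d p (fun q => coord c q 0 i) h.
  by move=> i; exact: trans Ac _ cp _ _ Ad dp.
have /choice[W WE] := hE.
have [co _ _ _] := charts c Ac; have [do_ dinj _ dim] := charts d Ad.
have imo : open (coord d @` (dom c `&` dom d)).
  by apply: dim; [exact: openI|move=> q []].
have Wo i : open (W i) by case: (WE i).
(* Intersecting with the image of the overlap forces [q] into [dom c], by injectivity of
   [coord d]. *)
exists ([set x | forall i, W i x] `&` (coord d @` (dom c `&` dom d))),
  (fun x => \row_i h i x); split.
- by apply: openI => //; exact: open_forall.
- by split; [move=> i; case: (WE i)|exists p].
- move=> j; have -> : (fun x => (\row_i h i x) 0 j) = h j.
    by apply/funext => x; rewrite mxE.
  by case: (WE j) => _ _ sh _; apply: smooth_on_sub sh => x [/(_ j)].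
- move=> q dq [Wq [r [cr dr] rq]].
  have rqE : r = q by apply: dinj; rewrite ?inE.
  subst r; split => //; apply/rowP => i; rewrite mxE.
  by case: (WE i) => _ _ _ ->.
Qed.
Local Notation compM := manifold_compatible.

Lemma slit_ex p v : tangent AM p v -> v <> 0 ->
  exists u, slit_proj u = p /\ eta u = v.
Proof.
move=> tv v0; have pv : (p, v) \in @slit_set R n M by rewrite inE.
by exists (exist _ (p, v) pv).
Qed.

Lemma eta_fibre u : fibre u (eta u).
Proof. by have := valP u; rewrite inE => -[]. Qed.

Lemma eta_neq0 u : eta u <> 0.
Proof. by have := valP u; rewrite inE => -[]. Qed.

Lemma coord_slit c u :
  coord (slit_chart c) u = row_mx (coord c (slit_proj u)) (vcoord c (eta u)).
Proof. by []. Qed.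

Lemma vcoord_neq0 c p v : AM c -> dom c p -> tangent AM p v -> v <> 0 ->
  vcoord c v <> 0.
Proof.
move=> Ac cp tv v0 vc0; apply: v0.
by apply: (tangent_eq compM Ac cp tv (tangent0 _ _)); rewrite vcoord0.
Qed.

Lemma smooth_on_lsubmx (W : set 'rV[R]_(n + n)) (U : set 'rV[R]_n) h :
  open W -> smooth_on U h -> (forall z, W z -> U (lsubmx z)) ->
  smooth_on W (fun z => h (lsubmx z)).
Proof.
move=> Wo sh WU; apply: (smooth_on_comp Wo sh WU) => j.
have -> : (fun x : 'rV[R]_(n + n) => lsubmx x 0 j) = (fun x => x 0 (lshift n j)).
  by apply/funext => x; rewrite mxE.
exact: smooth_on_coord.
Qed.

Lemma open_lsubmx (U : set 'rV[R]_n) : open U ->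
  open [set z : 'rV[R]_(n + n) | U (lsubmx z)].
Proof.
move=> Uo; rewrite (_ : mkset _ = [set z | setT z /\ U (lsubmx z)]); last first.
  by apply/seteqP; split => z //= [].
apply: open_preimage_row => // [|j]; first exact: openT.
have -> : (fun x : 'rV[R]_(n + n) => lsubmx x 0 j) = (fun x => x 0 (lshift n j)).
  by apply/funext => x; rewrite mxE.
by apply: smooth_on_coord; exact: openT.
Qed.

Lemma open_rsubmx_neq0 : open [set z : 'rV[R]_(n + n) | rsubmx z <> 0].
Proof.
rewrite (_ : mkset _ = [set z | setT z /\ (~` [set 0]) (rsubmx z)]); last first.
  by apply/seteqP; split => z //= [].
apply: open_preimage_row => [||j]; first exact: openT.
  by rewrite openC; apply: accessible_closed_set1; exact/hausdorff_accessible/norm_hausdorff.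
have -> : (fun x : 'rV[R]_(n + n) => rsubmx x 0 j) = (fun x => x 0 (rshift n j)).
  by apply/funext => x; rewrite mxE.
by apply: smooth_on_coord; exact: openT.
Qed.

(** The image of a slit chart is the image of [c] times the nonzero vectors, because every nonzero
    row of components is realised by a [chart_vector]. The transition map sends (x, y) to Phi(x) and
    the differential of Phi at x applied to y. *)
Lemma slit_compatible : compatible SA.
Proof.
have [coverM imM trM] := compM; split.
- move=> u; have [c Ac cp] := coverM (slit_proj u).
  by exists (slit_chart c) => //; exists c.
- move=> _ [c Ac <-].
  have -> : coord (slit_chart c) @` dom (slit_chart c) =
      [set z | (coord c @` dom c) (lsubmx z)] `&` [set z | rsubmx z <> 0].
    apply/seteqP; split=> z.
      move=> [u cu <-]; rewrite coord_slit; split => /=.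
        by rewrite row_mxKl; exists (slit_proj u).
      by rewrite row_mxKr; exact: vcoord_neq0 Ac cu (eta_fibre u) (@eta_neq0 u).
    move=> [[p cp pz] /= z0].
    have tv := chart_vector_tangent compM (rsubmx z) Ac cp.
    have vE := vcoord_chart_vector compM (rsubmx z) Ac cp.
    have [|u [up uv]] := slit_ex tv.
      by move=> v0; apply: z0; rewrite -vE v0 vcoord0.
    exists u; first by rewrite /= up.
    by apply: (etrans (coord_slit c u)); rewrite up uv vE pz hsubmxK.
  apply: openI; last exact: open_rsubmx_neq0.
  exact/open_lsubmx/imM.
- move=> _ _ u [c Ac <-] [d Ad <-] /= cu du.
  have [W [Phi [Wo Wp sPhi PhiE]]] := trM c d _ Ac Ad cu du.
  pose dPhi (z : 'rV[R]_(n + n)) i : R := \sum_(k < n) z 0 (rshift n k) *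
    'D_(delta_mx 0 k) (fun x => Phi x 0 i) (lsubmx z).
  have W'o := open_lsubmx Wo.
  exists [set z | W (lsubmx z)],
    (fun z => row_mx (Phi (lsubmx z)) (\row_i dPhi z i)); split => //.
  + by rewrite /= row_mxKl.
  + move=> j; case: (split_ordP j) => k ->.
      under [X in smooth_on _ X]funext do rewrite row_mxEl.
      exact: (smooth_on_lsubmx W'o (sPhi k)).
    under [X in smooth_on _ X]funext do rewrite row_mxEr mxE.
    apply: smooth_on_sum => // i; apply: smooth_onM => //.
      exact: smooth_on_coord.
    exact: (smooth_on_lsubmx W'o (smooth_on_partial i (sPhi k))).
  + move=> u' du'; rewrite /= row_mxKl => Wu'.
    have [cu' E] := PhiE _ du' Wu'; split => //.
    apply: (etrans (coord_slit c u')); rewrite E; congr row_mx.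
    apply/rowP => i; rewrite !mxE.
    rewrite (tangentE compM Ad du' (eta_fibre u')
      (_ : local_expr d _ _ (fun x => Phi x 0 i))); last first.
      by exists W; split => // q dq Wq; have [_ ->] := PhiE q dq Wq.
    rewrite derive_sumE; last exact: smooth_on_differentiable (sPhi i) Wu'.
    by apply: eq_bigr => k _; rewrite row_mxEr row_mxKl.
Qed.
Local Notation compS := slit_compatible.

Lemma slit_chart_atlas c : AM c -> SA (slit_chart c).
Proof. by exists c. Qed.

Lemma chart_ex p : exists2 c, AM c & dom c p.
Proof. by have [] := compM. Qed.

Lemma local_expr_pull c u f h : local_expr c (slit_proj u) f h ->
  local_expr (slit_chart c) u (f \o slit_proj) (fun z => h (lsubmx z)).
Proof.
move=> [W [Wo Wp sh fh]]; have W'o := open_lsubmx Wo.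
exists [set z | W (lsubmx z)]; split => //.
- by rewrite coord_slit /= row_mxKl.
- exact: smooth_on_lsubmx W'o sh _.
- by move=> q cq /=; rewrite row_mxKl => Wq; rewrite fh.
Qed.

(** Freezing the fibre coordinates at those of [u] loses nothing: over each nearby [q] there is a
    vector with these components, it is nonzero because [eta u] is, and [k] can be read at that
    point of the slit bundle. *)
Lemma local_expr_section c u f k : AM c -> dom c (slit_proj u) ->
  local_expr (slit_chart c) u (f \o slit_proj) k ->
  local_expr c (slit_proj u) f (fun x => k (row_mx x (vcoord c (eta u)))).
Proof.
move=> Ac cu [W [Wo Wp sk fk]]; set y := vcoord c (eta u).
have sy (U : set 'rV[R]_n) j : open U -> smooth_on U (fun x => row_mx x y 0 j).
  move=> Uo; case: (split_ordP j) => i ->.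
    under [X in smooth_on _ X]funext do rewrite row_mxEl.
    exact: smooth_on_coord.
  under [X in smooth_on _ X]funext do rewrite row_mxEr.
  exact: smooth_on_cst.
have W'o : open [set x | setT x /\ W (row_mx x y)].
  by apply: open_preimage_row => // [|j]; [exact: openT|apply: sy; exact: openT].
exists [set x | setT x /\ W (row_mx x y)]; split => //.
  by apply: (smooth_on_comp W'o sk) => [x []//|j]; exact: sy.
move=> q cq [_ Wq].
have tv := chart_vector_tangent compM y Ac cq.
have vE := vcoord_chart_vector compM y Ac cq.
have [|u' [uq uv]] := slit_ex tv.
  move=> v0; apply: (vcoord_neq0 Ac cu (eta_fibre u) (@eta_neq0 u)).
  by rewrite -/y -vE v0 vcoord0.
rewrite -uq in cq Wq *; rewrite -[LHS]/((f \o slit_proj) u') fk //.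
  by rewrite coord_slit uv vE.
by rewrite coord_slit uv vE.
Qed.

Lemma smooth_at_pull u f :
  smooth_at SA u (f \o slit_proj) <-> smooth_at AM (slit_proj u) f.
Proof.
have [c Ac cu] := chart_ex (slit_proj u); split=> sf.
  have [k fk] := sf _ (slit_chart_atlas Ac) cu.
  exact: (local_expr_smooth_at compM Ac cu (local_expr_section Ac cu fk)).
have [h fh] := sf _ Ac cu.
by apply: (local_expr_smooth_at compS (slit_chart_atlas Ac) cu (local_expr_pull fh)).
Qed.

(** If [f] is not smooth at the base point, then by [smooth_at_pull] neither is its pullback at [u],
    and both sides are 0. *)
Lemma rhoE u v f : tangent SA u v -> rho u v f = v (f \o slit_proj).
Proof.
move=> [_ v0]; rewrite /rho /on_smooth.
case: ifPn => // /asboolPn nf; rewrite v0 // => /smooth_at_pull.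
exact: nf.
Qed.

Lemma rho_linear u a v w : rho u (a *: v + w) = a *: rho u v + rho u w.
Proof.
apply/funext => f; rewrite !fctE /rho /on_smooth.
by case: ifP => //; rewrite scaler0 addr0.
Qed.

Lemma rhoB u v w : rho u (v - w) = rho u v - rho u w.
Proof. by rewrite addrC -scaleN1r rho_linear scaleN1r addrC. Qed.

Lemma rho_expr c u v f h : AM c -> dom c (slit_proj u) -> tangent SA u v ->
  local_expr c (slit_proj u) f h ->
  rho u v f = 'D_(lsubmx (vcoord (slit_chart c) v)) h (coord c (slit_proj u)).
Proof.
move=> Ac cu tv fh; rewrite rhoE //.
rewrite (tangentE compS (slit_chart_atlas Ac) cu tv (local_expr_pull fh)).
by rewrite derive_lsubmx coord_slit row_mxKl.
Qed.

Lemma rho_fibre u v : tangent SA u v -> fibre u (rho u v).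
Proof.
move=> tv; split=> [c Ac cu|F nF]; last by rewrite /rho /on_smooth asboolF.
by eexists => F h sF Fh; exact: rho_expr Fh.
Qed.

Lemma vcoord_rho c u v : AM c -> dom c (slit_proj u) -> tangent SA u v ->
  vcoord c (rho u v) = lsubmx (vcoord (slit_chart c) v).
Proof.
move=> Ac cu tv; apply/rowP => i; rewrite mxE.
by rewrite (rho_expr Ac cu tv (local_expr_coord c _ i)) derive_coord.
Qed.

Lemma rho_surj u w : fibre u w -> exists2 v, tangent SA u v & rho u v = w.
Proof.
move=> fw; have [c Ac cu] := chart_ex (slit_proj u).
pose v := chart_vector SA (slit_chart c) u (row_mx (vcoord c w) 0).
have tv : tangent SA u v by exact: (chart_vector_tangent compS _ (slit_chart_atlas Ac) cu).
exists v => //; apply: (tangent_eq compM Ac cu (rho_fibre tv) fw).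
rewrite vcoord_rho // vcoord_chart_vector ?row_mxKl //; first exact: compS.
exact: slit_chart_atlas.
Qed.

(** In a slit chart the curve is the straight line in direction (0, w). Near t = 0 its fibre
    coordinates stay nonzero, so [insub] succeeds and the default 0 does not enter the
    derivative. *)
Lemma gamma_curve c u w F h : AM c -> dom c (slit_proj u) -> fibre u w ->
  local_expr (slit_chart c) u F h ->
  is_derive (0 : R) (1 : R) (fun t : R =>
    oapp F 0 (insub (slit_proj u, eta u + t *: w) : option (slit M)))
    ('D_(row_mx 0 (vcoord c w)) h (coord (slit_chart c) u)).
Proof.
move=> Ac cu fw Fh.
have := is_derive_line0 (row_mx 0 (vcoord c w)) (local_expr_differentiable Fh).
apply: near_eq_is_derive.
have [W [Wo Wp sh FE]] := Fh.
pose W' := W `&` [set z | rsubmx z <> 0].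
have W'o : open W' by apply: openI => //; exact: open_rsubmx_neq0.
have W'p : W' (coord (slit_chart c) u).
  split => //=; rewrite row_mxKr.
  exact: vcoord_neq0 Ac cu (eta_fibre u) (@eta_neq0 u).
have E t : row_mx (coord c (slit_proj u)) (vcoord c (eta u + t *: w)) =
    coord (slit_chart c) u + t *: row_mx 0 (vcoord c w).
  by rewrite coord_slit scale_row_mx add_row_mx scaler0 addr0 addrC vcoordP addrC.
apply: filterS (near_line (row_mx 0 (vcoord c w)) (open_nbhs_nbhs (conj W'o W'p))) => t.
rewrite -E => -[Wt /=]. rewrite row_mxKr => vt0.
have tt : tangent AM (slit_proj u) (eta u + t *: w).
  by have := tangent_linear t fw (eta_fibre u); rewrite addrC.
have ut : (slit_proj u, eta u + t *: w) \in @slit_set R n M.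
  by rewrite inE; split => //= v0; apply: vt0; rewrite v0 vcoord0.
rewrite insubT /=.
pose u' : slit M := exist _ (slit_proj u, eta u + t *: w) ut.
have cu' : dom (slit_chart c) u' by [].
have Wu' : W (coord (slit_chart c) u') by [].
exact: (esym (FE u' cu' Wu')).
Qed.

Lemma gammaE c u w F h : AM c -> dom c (slit_proj u) -> fibre u w ->
  local_expr (slit_chart c) u F h ->
  gamma u w F = 'D_(row_mx 0 (vcoord c w)) h (coord (slit_chart c) u).
Proof.
move=> Ac cu fw Fh; rewrite /gamma /on_smooth asboolT; last first.
  exact: (local_expr_smooth_at compS (slit_chart_atlas Ac) cu Fh).
by rewrite derive1E; have [_] := gamma_curve Ac cu fw Fh.
Qed.

Lemma gamma_tangent u w : fibre u w -> tangent SA u (gamma u w).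
Proof.
move=> fw; split => [_ [c Ac <-] cu|F nF]; last first.
  by rewrite /gamma /on_smooth asboolF.
by eexists => F h sF Fh; exact: gammaE.
Qed.

Lemma vcoord_gamma c u w : AM c -> dom c (slit_proj u) -> fibre u w ->
  vcoord (slit_chart c) (gamma u w) = row_mx 0 (vcoord c w).
Proof.
move=> Ac cu fw; apply/rowP => i; rewrite mxE.
by rewrite (gammaE Ac cu fw (local_expr_coord _ u i)) derive_coord.
Qed.

Lemma rho_gamma u w : fibre u w -> rho u (gamma u w) = 0.
Proof.
move=> fw; have [c Ac cu] := chart_ex (slit_proj u).
have tg := gamma_tangent fw.
apply: (tangent_eq compM Ac cu (rho_fibre tg) (tangent0 _ _)).
by rewrite vcoord_rho // vcoord_gamma // row_mxKl vcoord0.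
Qed.

Lemma gamma_linear u a v w : fibre u v -> fibre u w ->
  gamma u (a *: v + w) = a *: gamma u v + gamma u w.
Proof.
move=> fv fw; have [c Ac cu] := chart_ex (slit_proj u).
have fvw := tangent_linear a fv fw.
have tgv := gamma_tangent fv; have tgw := gamma_tangent fw.
apply: (tangent_eq compS (slit_chart_atlas Ac) cu (gamma_tangent fvw)).
  exact: tangent_linear.
rewrite vcoordP !vcoord_gamma // vcoordP.
by rewrite scale_row_mx add_row_mx scaler0 addr0.
Qed.

Lemma gamma_pull u w f : fibre u w -> gamma u w (f \o slit_proj) = 0.
Proof.
by move=> fw; rewrite -(rhoE f (gamma_tangent fw)) rho_gamma.
Qed.

(** The curve that defines [gamma] stays in one fibre, on which [phi \o slit_proj] is constant. *)
Lemma gamma_fibrewise_scale u w (phi : M -> R) F : fibre u w ->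
  smooth_at SA u F -> smooth_at SA u (fun u' => phi (slit_proj u') * F u') ->
  gamma u w (fun u' => phi (slit_proj u') * F u') =
  phi (slit_proj u) * gamma u w F.
Proof.
move=> fw sF spF; have [c Ac cu] := chart_ex (slit_proj u).
have [h Fh] := sF _ (slit_chart_atlas Ac) cu.
rewrite (gammaE Ac cu fw Fh) /gamma /on_smooth asboolT // derive1E.
have dG := gamma_curve Ac cu fw Fh.
have -> : (fun t : R => oapp (fun u' => phi (slit_proj u') * F u') 0
    (insub (slit_proj u, eta u + t *: w) : option (slit M))) =
    (fun t => phi (slit_proj u) *:
      oapp F 0 (insub (slit_proj u, eta u + t *: w) : option (slit M))).
  apply/funext => t; case: insubP => [u' _ u'E|_] /=; last by rewrite scaler0.
  by rewrite /slit_proj u'E.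
by have [_ ->] := is_deriveZ (phi (slit_proj u)) dG.
Qed.

(** * Smoothness of pi-vector fields and of their vertical lifts *)

Section PiVectorFields.
Implicit Types X Y Z : slit M -> tvec R M.

Lemma pi_vfield_local_expr c u X f : AM c -> dom c (slit_proj u) ->
  pi_vfield X -> smooth_at AM (slit_proj u) f ->
  exists h, local_expr (slit_chart c) u (fun u' => X u' f) h.
Proof. by move=> Ac cu [_ sX] sf; exact: sX sf _ (slit_chart_atlas Ac) cu. Qed.

Lemma pi_vfield_coord c u X : AM c -> dom c (slit_proj u) -> pi_vfield X ->
  exists Xc : 'I_n -> 'rV[R]_(n + n) -> R, forall i,
    local_expr (slit_chart c) u (fun u' => X u' (fun q => coord c q 0 i)) (Xc i).
Proof.
move=> Ac cu pX.
have /choice[Xc XcE] : forall i, exists h, local_expr (slit_chart c) u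
    (fun u' => X u' (fun q => coord c q 0 i)) h; last by exists Xc.
by move=> i; apply: pi_vfield_local_expr => //; exact: (smooth_at_coord compM i Ac cu).
Qed.

Lemma pi_vfield_linear a X Y : pi_vfield X -> pi_vfield Y ->
  pi_vfield (fun u => a *: X u + Y u).
Proof.
move=> pX pY; split=> [u|u f sf].
  by apply: tangent_linear; [exact: pX.1|exact: pY.1].
have [c Ac cu] := chart_ex (slit_proj u).
have [h hE] := pi_vfield_local_expr Ac cu pX sf.
have [k kE] := pi_vfield_local_expr Ac cu pY sf.
apply: (local_expr_smooth_at compS (slit_chart_atlas Ac) cu).
exact: (local_exprD (local_exprM (local_expr_cst _ _ a) hE) kE).
Qed.

Lemma pi_vfield0 : pi_vfield (fun u : slit M => 0 : tvec R M).
Proof.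
split=> [u|u f sf]; first exact: tangent0.
have [c Ac cu] := chart_ex (slit_proj u).
exact: (local_expr_smooth_at compS (slit_chart_atlas Ac) cu (local_expr_cst _ _ 0)).
Qed.

Lemma pi_vfieldD X Y : pi_vfield X -> pi_vfield Y ->
  pi_vfield (fun u => X u + Y u).
Proof.
move=> pX pY; have := pi_vfield_linear 1 pX pY.
by under eq_fun do rewrite scale1r.
Qed.

Lemma pi_vfieldB X Y : pi_vfield X -> pi_vfield Y ->
  pi_vfield (fun u => X u - Y u).
Proof.
move=> pX pY; have := pi_vfield_linear (-1) pY pX.
by under eq_fun do rewrite scaleN1r addrC.
Qed.

Lemma fibre_field_local_expr c u X f h (Xc : 'I_n -> 'rV[R]_(n + n) -> R) :
  AM c -> dom c (slit_proj u) -> (forall u', fibre u' (X u')) ->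
  (forall i, local_expr (slit_chart c) u
    (fun u' => X u' (fun q => coord c q 0 i)) (Xc i)) ->
  local_expr c (slit_proj u) f h ->
  local_expr (slit_chart c) u (fun u' => X u' f)
    (fun z => \sum_i Xc i z * 'D_(delta_mx 0 i) h (lsubmx z)).
Proof.
move=> Ac cu fX XcE fh.
have [W [Wo Wp sh near]] := smooth_at_near compM Ac fh.
have ed i : local_expr (slit_chart c) u
    ((fun q => 'D_(delta_mx 0 i) h (coord c q)) \o slit_proj)
    (fun z => 'D_(delta_mx 0 i) h (lsubmx z)).
  apply: (@local_expr_pull c u _ ('D_(delta_mx 0 i) h)); exists W; split => //.
  exact: smooth_on_partial.
apply: (local_expr_sub (open_lsubmx Wo) _ _
  (local_expr_sum (fun i => local_exprM (XcE i) (ed i)))).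
  by rewrite coord_slit /= row_mxKl.
move=> u' cu' /=; rewrite row_mxKl => Wu'.
have [_ _ lu'] := near _ cu' Wu'.
rewrite (tangentE compM Ac cu' (fX u') lu') derive_sumE.
  by apply: eq_bigr => i _; rewrite mxE.
exact: local_expr_differentiable lu'.
Qed.

Lemma eta_local_expr c u i : local_expr (slit_chart c) u
  (fun u' => eta u' (fun q => coord c q 0 i)) (fun z => z 0 (rshift n i)).
Proof.
have := local_expr_coord (slit_chart c) u (rshift n i).
by under eq_fun do rewrite coord_slit row_mxEr mxE.
Qed.

Lemma eta_pi_vfield : pi_vfield (@eta R n M).
Proof.
split=> [u|u f sf]; first exact: eta_fibre.
have [c Ac cu] := chart_ex (slit_proj u).
have [h fh] := sf c Ac cu.
apply: (local_expr_smooth_at compS (slit_chart_atlas Ac) cu).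
exact: (fibre_field_local_expr Ac cu eta_fibre (eta_local_expr c u) fh).
Qed.

Lemma gammaF_vfield X : pi_vfield X -> vfield SA (gammaF X).
Proof.
move=> pX; have fX u : fibre u (X u) by exact: pX.1.
split=> [u|u F sF]; first exact: gamma_tangent.
have [c Ac cu] := chart_ex (slit_proj u).
have [Xc XcE] := pi_vfield_coord Ac cu pX.
have [h Fh] := sF _ (slit_chart_atlas Ac) cu.
(* The components of gamma X are 0 along the base and those of [X] along the fibre. *)
have gE : forall i, exists g, local_expr (slit_chart c) u
    (fun u' => gammaF X u' (fun q' => coord (slit_chart c) q' 0 i)) g.
  move=> i; have gE u' : dom c (slit_proj u') ->
      gammaF X u' (fun q' => coord (slit_chart c) q' 0 i) =
      row_mx 0 (vcoord c (X u')) 0 i.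
    by move=> cu'; rewrite -(vcoord_gamma Ac cu' (fX u')) mxE.
  case: (split_ordP i) gE => j -> gE.
    exists (fun=> 0); apply: (local_expr_sub openT _ _ (local_expr_cst _ _ 0)) => //.
    by move=> u' cu' _; rewrite gE // row_mxEl mxE.
  exists (Xc j); apply: (local_expr_sub openT _ _ (XcE j)) => //.
  by move=> u' cu' _; rewrite gE // row_mxEr mxE.
have [g {}gE] := choice gE.
apply: (local_expr_smooth_at compS (slit_chart_atlas Ac) cu).
apply: (tangent_field_local_expr compS (slit_chart_atlas Ac) cu _ gE Fh) => u'.
exact: gamma_tangent.
Qed.

End PiVectorFields.

End SlitBundle.

(** * Torsion of a regular connection *)

Section Connections.
Context {R : realType} {n : nat} {M : manifold R n}.

Notation AM := (@atlas R n M).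
Notation SA := (@slit_atlas R n M).
Local Notation compM := (@manifold_compatible R n M).
Local Notation compS := (@slit_compatible R n M).
Implicit Types (c : chart R M n) (u : slit M) (X Y Z : slit M -> tvec R M).

Lemma tangent_cst u v r : tangent SA u v -> v (fun=> r) = 0.
Proof.
move=> tv; have [c Ac cu] := chart_ex (slit_proj u).
rewrite (tangentE compS (slit_chart_atlas Ac) cu tv (local_expr_cst _ u r)).
exact: derive_cst.
Qed.

(* The derivative of [Y] along [gamma X] for the flat connections of the
   fibres. *)
Definition vderiv X Y : slit M -> tvec R M :=
  fun u f => gamma u (X u) (fun q => Y q f).

(** The curve of [gamma] stays over [slit_proj u], and every value of [Y] over that point kills
    [f]. *)
Lemma vderiv_nonsmooth X Y u f : (forall u, fibre u (Y u)) ->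
  ~ smooth_at AM (slit_proj u) f -> vderiv X Y u f = 0.
Proof.
move=> fY nf; rewrite /vderiv /gamma /on_smooth; case: ifP => // _.
rewrite (_ : (fun t : R => _) = (fun=> 0)); first exact: derive1_cst.
apply/funext => t; case: insubP => [u' _ u'E|_] //=.
have [_] := fY u'; apply; rewrite /slit_proj u'E; exact: nf.
Qed.

Lemma vderiv_coord c u X Y i (Yc : 'rV[R]_(n + n) -> R) :
  AM c -> dom c (slit_proj u) -> fibre u (X u) ->
  local_expr (slit_chart c) u (fun u' => Y u' (fun q => coord c q 0 i)) Yc ->
  vderiv X Y u (fun q => coord c q 0 i) =
  'D_(row_mx 0 (vcoord c (X u))) Yc (coord (slit_chart c) u).
Proof. by move=> Ac cu fX YE; rewrite /vderiv (gammaE Ac cu fX YE). Qed.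

(** In the local expression of Y f, the sum of the Yc_i d_i h, the factors d_i h depend on the base
    coordinates only. A vertical derivative thus acts on the components of [Y] alone, which makes
    [vderiv X Y u] a tangent vector. *)
Lemma vderiv_expr c u X Y f h : AM c -> dom c (slit_proj u) ->
  pi_vfield X -> pi_vfield Y -> local_expr c (slit_proj u) f h ->
  vderiv X Y u f = 'D_(vcoord c (vderiv X Y u)) h (coord c (slit_proj u)).
Proof.
move=> Ac cu pX pY fh; have fX : fibre u (X u) by exact: pX.1.
have [Yc YcE] := pi_vfield_coord Ac cu pY.
have Yf := fibre_field_local_expr Ac cu pY.1 YcE fh.
have dY i := local_expr_differentiable (YcE i).
have [W [Wo Wp sh _]] := fh.
have Wp' : W (lsubmx (coord (slit_chart c) u)) by rewrite coord_slit row_mxKl.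
have dh i : differentiable
    (fun z : 'rV[R]_(n + n) => 'D_(delta_mx 0 i) h (lsubmx z))
    (coord (slit_chart c) u).
  apply: (@smooth_on_differentiable _ _ _ _ _ _ Wp').
  exact: (smooth_on_lsubmx (open_lsubmx Wo) (smooth_on_partial i sh)).
rewrite [LHS](gammaE Ac cu fX Yf).
rewrite [RHS]derive_sumE; last exact: local_expr_differentiable fh.
set w := row_mx 0 _.
have -> : (fun z => \sum_i Yc i z * 'D_(delta_mx 0 i) h (lsubmx z)) =
    \sum_i (Yc i * (fun z => 'D_(delta_mx 0 i) h (lsubmx z))).
  by apply/funext => z; rewrite fct_sumE.
rewrite derive_sum; last first.
  by move=> i; apply: derivableM; apply: diff_derivable.
apply: eq_bigr => i _; rewrite deriveM; [|exact: diff_derivable..].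
have := derive_lsubmx ('D_(delta_mx 0 i) h) w (coord (slit_chart c) u).
rewrite [lsubmx w]row_mxKl derive0 => ->; rewrite scaler0 add0r.
rewrite mxE (vderiv_coord Ac cu fX (YcE i)) coord_slit row_mxKl.
by rewrite [LHS]mulrC.
Qed.

Lemma vderiv_pi_vfield X Y : pi_vfield X -> pi_vfield Y -> pi_vfield (vderiv X Y).
Proof.
move=> pX pY; split=> [u|u f sf]; last first.
  by have [_] := gammaF_vfield pX; apply; exact: pY.2.
split=> [c Ac cu|f nf]; last exact: vderiv_nonsmooth pY.1 nf.
by exists (vcoord c (vderiv X Y u)) => f h _ fh; exact: vderiv_expr.
Qed.

Lemma vderiv_eta X : pi_vfield X -> vderiv X eta = X.
Proof.
move=> pX; apply/funext => u; have [c Ac cu] := chart_ex (slit_proj u).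
have pXe := vderiv_pi_vfield pX eta_pi_vfield.
apply: (tangent_eq compM Ac cu (pXe.1 u) (pX.1 u)).
apply/rowP => i; rewrite [LHS]mxE.
rewrite (vderiv_coord Ac cu (pX.1 u) (eta_local_expr c u i)).
by rewrite derive_coord row_mxEr.
Qed.

Lemma vderivDl X X' Y u : pi_vfield X -> pi_vfield X' ->
  vderiv (fun u => X u + X' u) Y u = vderiv X Y u + vderiv X' Y u.
Proof.
move=> pX pX'; apply/funext => f; rewrite /vderiv.
have := gamma_linear 1 (pX.1 u) (pX'.1 u); rewrite !scale1r => ->.
by [].
Qed.

Section LinearConnection.
Variable D : connection M.
Hypothesis linD : linear_connection D.

Lemma conn_pi_vfield V Y : vfield SA V -> pi_vfield Y -> pi_vfield (cov D V Y).
Proof. by case: linD => _ _ _ _; exact. Qed.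

Lemma connDv u v w Y : tangent SA u v -> tangent SA u w -> pi_vfield Y ->
  D u (v + w) Y = D u v Y + D u w Y.
Proof.
case: linD => _ lin _ _ _ tv tw pY.
by have := lin u 1 v w Y tv tw pY; rewrite !scale1r.
Qed.

Lemma connBv u v w Y : tangent SA u v -> tangent SA u w -> pi_vfield Y ->
  D u (v - w) Y = D u v Y - D u w Y.
Proof.
case: linD => _ lin _ _ _ tv tw pY.
by have := lin u (-1) w v Y tw tv pY; rewrite !scaleN1r addrC => ->; rewrite addrC.
Qed.

Lemma conn0 u v : tangent SA u v -> D u v (fun=> 0) = 0.
Proof.
case: linD => _ _ add _ _ tv.
have := add u v _ _ tv pi_vfield0 pi_vfield0.
under [X in D u v X]eq_fun do rewrite addr0.
by move=> /(congr1 (fun w => w - D u v (fun=> 0))); rewrite addrK subrr => <-.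
Qed.

Hypothesis regD : regular D.

(** A preimage exists, so [xget] does not fall back on 0: lift [w] to any tangent vector and drop
    its vertical part, which [rho] kills. *)
Lemma betaP u w : fibre u w ->
  horizontal D u (beta D u w) /\ rho u (beta D u w) = w.
Proof.
move=> fw; rewrite /beta; case: xgetP => // no; exfalso.
have [v tv vE] := rho_surj fw.
have [split_ _ _] := regD.
have [v1 [v2 [[tv1 v1E] hv2 vE']]] := split_ u v tv.
apply: (no v2); split => //.
have := rho_linear u 1 v1 v2; rewrite !scale1r -vE' v1E add0r => <-.
exact: vE.
Qed.

Lemma horizontal_inj u v w : horizontal D u v -> horizontal D u w ->
  rho u v = rho u w -> v = w.
Proof.
move=> [tv Kv] [tw Kw] vw; have [_ uniq _] := regD.
apply/eqP; rewrite -subr_eq0; apply/eqP; apply: (uniq u); split.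
- exact: tangentB.
- by rewrite rhoB vw subrr.
- exact: tangentB.
- rewrite /Kmap connBv //; last exact: eta_pi_vfield.
  by rewrite [D u v _]Kv [D u w _]Kw subrr.
Qed.

Lemma betaF_tangent X u : pi_vfield X -> tangent SA u (betaF D X u).
Proof. by move=> pX; have [[]] := betaP (pX.1 u). Qed.

Lemma rhoF_betaF X : pi_vfield X -> rhoF (betaF D X) = X.
Proof. by move=> pX; apply/funext => u; have [] := betaP (pX.1 u). Qed.

Lemma betaF_vfield X : pi_vfield X -> vfield SA (betaF D X).
Proof. by case: regD => _ _; exact. Qed.

(** One covariant derivative in the torsion vanishes because rho (gamma X) = 0. In the bracket term
    gamma X kills functions pulled back from M, while beta Y applied to the pullback of f gives Y f;
    what remains is gamma X (Y f). *)
Lemma Ttor_vderiv X Y : pi_vfield X -> pi_vfield Y ->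
  Ttor D X Y = fun u => cov D (gammaF X) Y u - vderiv X Y u.
Proof.
move=> pX pY; apply/funext => u.
have tgX : tangent SA u (gammaF X u) by exact/gamma_tangent/pX.1.
have rg : rhoF (gammaF X) = fun=> 0.
  by apply/funext => u'; exact/rho_gamma/pX.1.
rewrite /Ttor /torsion rhoF_betaF // rg [cov D (betaF D Y) _ u]conn0; last first.
  exact: betaF_tangent.
rewrite subr0; congr (_ - _); apply/funext => f.
rewrite /rho /on_smooth; case: asboolP => sf; last first.
  by rewrite vderiv_nonsmooth //; exact: pY.1.
rewrite /bracket /on_smooth asboolT; last exact/smooth_at_pull.
rewrite (_ : (fun q => gammaF X q (f \o slit_proj)) = fun=> 0); last first.
  by apply/funext => q; exact/gamma_pull/pX.1.
rewrite (tangent_cst 0 (betaF_tangent u pY)) subr0.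
congr (gamma u (X u) _); apply/funext => q.
rewrite -(rhoE f (betaF_tangent q pY)).
by rewrite -[rho _ _]/(rhoF (betaF D Y) q) rhoF_betaF.
Qed.

Lemma Ttor_pi_vfield X Y : pi_vfield X -> pi_vfield Y -> pi_vfield (Ttor D X Y).
Proof.
move=> pX pY; rewrite Ttor_vderiv //; apply: pi_vfieldB.
  by apply: conn_pi_vfield => //; exact: gammaF_vfield.
exact: vderiv_pi_vfield.
Qed.

Lemma cov_gammaF X Y : pi_vfield X -> pi_vfield Y ->
  cov D (gammaF X) Y = fun u => Ttor D X Y u + vderiv X Y u.
Proof.
by move=> pX pY; apply/funext => u; rewrite Ttor_vderiv // subrK.
Qed.

Lemma TtorDl X X' Y u : pi_vfield X -> pi_vfield X' -> pi_vfield Y ->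
  Ttor D (fun u => X u + X' u) Y u = Ttor D X Y u + Ttor D X' Y u.
Proof.
move=> pX pX' pY; have pXX' := pi_vfieldD pX pX'.
rewrite !Ttor_vderiv // vderivDl // opprD addrACA; congr (_ + _).
rewrite /cov /gammaF; have := gamma_linear 1 (pX.1 u) (pX'.1 u).
rewrite !scale1r => ->; apply: connDv => //; apply: gamma_tangent.
  exact: pX.1.
exact: pX'.1.
Qed.

End LinearConnection.
End Connections.

(* Keeps unification from unfolding derivatives to limits. *)
#[local] Opaque derive derive1.

(** * Euler's relation for homogeneous functions *)

Section Euler.
Context {R : realType} {n : nat}.
Implicit Types (W : set 'rV[R]_(n + n)) (f : 'rV[R]_(n + n) -> R).

(* The coordinates of a slit chart are (x^i, y^i); this is d/dy^i. *)
Notation pdy i f := ('D_(delta_mx 0 (rshift n i)) f).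

(** Differentiate Euler's relation along y^k. The coordinate factors contribute one extra [pdy k f],
    which lowers the degree by one, and Schwarz puts the derivatives in the stated order. *)
Lemma euler_partial W f (r : R) k : open W -> smooth_on W f ->
  (forall z, W z -> \sum_j z 0 (rshift n j) * pdy j f z = r * f z) ->
  forall z, W z ->
    \sum_j z 0 (rshift n j) * pdy j (pdy k f) z = (r - 1) * pdy k f z.
Proof.
move=> Wo sf E z Wz.
have df : derivable f z (delta_mx 0 (rshift n k)).
  exact/diff_derivable/(smooth_on_differentiable sf Wz).
have dpf j : derivable (pdy j f) z (delta_mx 0 (rshift n k)).
  apply/diff_derivable/(@smooth_on_differentiable _ _ W) => //.
  exact: smooth_on_partial.
have dz j : derivable (fun y : 'rV[R]_(n + n) => y 0 (rshift n j)) z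
    (delta_mx 0 (rshift n k)).
  exact/diff_derivable/differentiable_coord.
have := derive_eq_on (delta_mx 0 (rshift n k)) Wo Wz E.
have -> : (fun z : 'rV[R]_(n + n) => \sum_j z 0 (rshift n j) * pdy j f z) =
    \sum_j ((fun z : 'rV[R]_(n + n) => z 0 (rshift n j)) * (pdy j f)).
  by apply/funext => y; rewrite fct_sumE.
rewrite derive_sum; last by move=> j; exact: (derivableM (dz j) (dpf j)).
have -> : 'D_(delta_mx 0 (rshift n k)) (fun z => r * f z) z = r * pdy k f z.
  exact: deriveZ.
have step j : 'D_(delta_mx 0 (rshift n k))
    ((fun z : 'rV[R]_(n + n) => z 0 (rshift n j)) * (pdy j f)) z =
    z 0 (rshift n j) * pdy j (pdy k f) z + pdy j f z * (k == j)%:R.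
  apply: etrans (deriveM (dz j) (dpf j)) _; rewrite derive_coord mxE.
  rewrite eqxx eq_rshift [j == k]eq_sym.
  exact: (congr1 (fun p => z 0 (rshift n j) * p + _)
    (schwarz (rshift n k) (rshift n j) Wo sf Wz)).
under eq_bigr do rewrite step.
have pick : \sum_j pdy j f z * (k == j)%:R = pdy k f z.
  rewrite (bigD1 k) //= eqxx mulr1 big1 ?addr0 // => j.
  by rewrite eq_sym => /negbTE ->; rewrite mulr0.
rewrite big_split /= pick => /(congr1 (fun p => p - pdy k f z)).
by rewrite addrK mulrBl mul1r.
Qed.

End Euler.

(** * The Cartan tensor *)

Section FinslerMetric.
Context {R : realType} {n : nat} {M : manifold R n}.

Notation AM := (@atlas R n M).
Notation SA := (@slit_atlas R n M).
Notation pdy i f := ('D_(delta_mx 0 (rshift n i)) f).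
Local Notation compM := (@manifold_compatible R n M).
Local Notation compS := (@slit_compatible R n M).
Implicit Types (c : chart R M n) (u : slit M) (X Y Z : slit M -> tvec R M).

Variable L : M -> tvec R M -> R.
Hypothesis finL : is_finsler L.
Notation g := (finsler_metric L).

Definition energy u : R := L (slit_proj u) (eta u) ^+ 2.

Lemma energy_local_expr c u : AM c -> dom c (slit_proj u) ->
  exists h, local_expr (slit_chart c) u energy h.
Proof.
move=> Ac cu; case: finL => _ sL _ _.
have [h hE] := sL u _ (slit_chart_atlas Ac) cu.
exists (fun z => h z * h z).
exact: (local_exprM hE hE).
Qed.

Lemma derive_vertical f (w : 'rV[R]_n) (z : 'rV[R]_(n + n)) :
  differentiable f z ->
  'D_(row_mx 0 w) f z = \sum_i w 0 i * pdy i f z.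
Proof.
move=> df; rewrite (derive_sumE _ df) big_split_ord /=.
rewrite [X in X + _]big1; last by move=> i _; rewrite row_mxEl mxE mul0r.
by rewrite add0r; apply: eq_bigr => i _; rewrite row_mxEr.
Qed.

Lemma finsler_metric_derive c u h v w : AM c -> dom c (slit_proj u) ->
  local_expr (slit_chart c) u energy h -> fibre u v -> fibre u w ->
  g u v w = 2^-1 * 'D_(row_mx 0 (vcoord c v)) ('D_(row_mx 0 (vcoord c w)) h)
    (coord (slit_chart c) u).
Proof.
move=> Ac cu [W [Wo Wu sh hE]] fv fw; apply: (congr1 (fun r => 2^-1 * r)).
set V := row_mx 0 (vcoord c v); set U := row_mx 0 (vcoord c w).
set a := coord (slit_chart c) u.
(* The expression [h] represents L^2 at nonzero vectors only, so both derivatives are taken inside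
   [W']. *)
pose W' := W `&` [set z | rsubmx z <> 0].
have W'o : open W' by apply: openI => //; exact: open_rsubmx_neq0.
have W'a : W' a.
  split => //=; rewrite row_mxKr.
  exact: vcoord_neq0 Ac cu (eta_fibre u) (@eta_neq0 _ _ _ u).
have E s t : row_mx (coord c (slit_proj u))
    (vcoord c (eta u + s *: v + t *: w)) = a + s *: V + t *: U.
  rewrite /a coord_slit !scale_row_mx !add_row_mx !scaler0 !addr0.
  rewrite [_ + t *: w]addrC vcoordP [eta u + _]addrC vcoordP addrC.
  by rewrite [_ + vcoord c _]addrC.
have Lh s t : W' (a + s *: V + t *: U) ->
    h (a + s *: V + t *: U) = L (slit_proj u) (eta u + s *: v + t *: w) ^+ 2.
  rewrite -E => -[Wst /=]; rewrite row_mxKr => st0.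
  have ft : fibre u (eta u + s *: v + t *: w).
    rewrite [_ + t *: w]addrC; apply: tangent_linear => //.
    by rewrite addrC; apply: tangent_linear => //; exact: eta_fibre.
  have [|u' [pu' eu']] := slit_ex ft.
    by move=> x0; apply: st0; rewrite x0 vcoord0.
  by rewrite -pu' -eu' -coord_slit -hE //= ?pu' // /energy -?pu' // eu' ?pu'.
have dh z : W' z -> differentiable h z.
  by move=> [Wz _]; exact: smooth_on_differentiable sh Wz.
have inner s : W' (a + s *: V) ->
    derive1 (fun t : R => L (slit_proj u) (eta u + s *: v + t *: w) ^+ 2) 0 =
    'D_U h (a + s *: V).
  move=> Ws; rewrite derive1E.
  have [_ <-] := is_derive_line0 U (dh _ Ws).
  apply: near_eq_derive.
  apply: filterS (near_line U (open_nbhs_nbhs (conj W'o Ws))) => t.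
  by move=> /Lh ->.
have dDh : differentiable ('D_U h) a.
  have sD : smooth_on W (fun z => \sum_i U 0 i * 'D_(delta_mx 0 i) h z).
    apply: smooth_on_sum => // i; apply: smooth_onM => //.
      exact: smooth_on_cst.
    exact: smooth_on_partial.
  apply: (near_eq_differentiable _ (smooth_on_differentiable sD Wu)).
  apply: (open_near Wo Wu) => z Wz; rewrite derive_sumE //.
  exact: smooth_on_differentiable sh Wz.
rewrite derive1E; have [_ <-] := is_derive_line0 V dDh.
apply: near_eq_derive.
apply: filterS (near_line V (open_nbhs_nbhs (conj W'o W'a))) => s.
exact: inner.
Qed.

Lemma finsler_metricE c u h v w : AM c -> dom c (slit_proj u) ->
  local_expr (slit_chart c) u energy h -> fibre u v -> fibre u w ->
  g u v w = 2^-1 * \sum_j \sum_k vcoord c v 0 j * vcoord c w 0 k *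
    pdy j (pdy k h) (coord (slit_chart c) u).
Proof.
move=> Ac cu hE fv fw; rewrite (finsler_metric_derive Ac cu hE fv fw).
have [W [Wo Wu sh _]] := hE; congr (_ * _).
set a := coord (slit_chart c) u.
pose k0 z := \sum_k vcoord c w 0 k * pdy k h z.
have sk : smooth_on W k0.
  apply: smooth_on_sum => // k; apply: smooth_onM => //.
    exact: smooth_on_cst.
  exact: smooth_on_partial.
have -> : 'D_(row_mx 0 (vcoord c v)) ('D_(row_mx 0 (vcoord c w)) h) a =
    'D_(row_mx 0 (vcoord c v)) k0 a.
  apply: (derive_eq_on _ Wo Wu) => z Wz.
  exact/derive_vertical/(smooth_on_differentiable sh Wz).
rewrite derive_vertical; last exact: smooth_on_differentiable sk Wu.
apply: eq_bigr => j _.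
have -> : k0 = \sum_k (vcoord c w 0 k \*: (pdy k h)).
  by apply/funext => z; rewrite fct_sumE.
have dp k : derivable (pdy k h) a (delta_mx 0 (rshift n j)).
  apply/diff_derivable/(@smooth_on_differentiable _ _ W) => //.
  exact: smooth_on_partial.
rewrite derive_sum; last by move=> k; exact: derivableZ.
rewrite mulr_sumr; apply: eq_bigr => k _.
by rewrite -mulrA; congr (_ * _); exact: deriveZ.
Qed.

#[local] Opaque finsler_metric.
#[local] Opaque gamma.

Lemma finsler_metricC u v w : fibre u v -> fibre u w -> g u v w = g u w v.
Proof.
move=> fv fw; have [c Ac cu] := chart_ex (slit_proj u).
have [h hE] := energy_local_expr Ac cu.
rewrite (finsler_metricE Ac cu hE fv fw) (finsler_metricE Ac cu hE fw fv).
rewrite [in RHS]exchange_big /=; apply: congr1.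
apply: eq_bigr => j _; apply: eq_bigr => k _.
have [W [Wo Wu sh _]] := hE; rewrite [vcoord c w 0 k * _]mulrC.
exact: congr1 (schwarz _ _ Wo sh Wu).
Qed.

Lemma finsler_metric_linear u a v v' w : fibre u v -> fibre u v' -> fibre u w ->
  g u (a *: v + v') w = a * g u v w + g u v' w.
Proof.
move=> fv fv' fw; have [c Ac cu] := chart_ex (slit_proj u).
have [h hE] := energy_local_expr Ac cu.
have fvv' := tangent_linear a fv fv'.
rewrite (finsler_metricE Ac cu hE fvv' fw) (finsler_metricE Ac cu hE fv fw).
rewrite (finsler_metricE Ac cu hE fv' fw) mulrCA -mulrDr; apply: congr1.
rewrite mulr_sumr -big_split /=; apply: eq_bigr => j _.
rewrite mulr_sumr -big_split /=; apply: eq_bigr => k _.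
by rewrite vcoordP !mxE; ring.
Qed.

Lemma finsler_metricDl u v v' w : fibre u v -> fibre u v' -> fibre u w ->
  g u (v + v') w = g u v w + g u v' w.
Proof.
move=> fv fv' fw; have := finsler_metric_linear 1 fv fv' fw.
by rewrite scale1r mul1r.
Qed.

Lemma finsler_metricDr u v w w' : fibre u v -> fibre u w -> fibre u w' ->
  g u v (w + w') = g u v w + g u v w'.
Proof.
move=> fv fw fw'.
rewrite (finsler_metricC fv (tangentD fw fw')) (finsler_metricDl fw fw' fv).
by rewrite (finsler_metricC fv fw) (finsler_metricC fv fw').
Qed.

Lemma finsler_metricBl u v v' w : fibre u v -> fibre u v' -> fibre u w ->
  g u (v - v') w = g u v w - g u v' w.
Proof.
move=> fv fv' fw; have := finsler_metric_linear (-1) fv' fv fw.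
by rewrite scaleN1r addrC => ->; rewrite mulN1r addrC.
Qed.

Lemma finsler_metric_local_expr c u h Y Z (Yc Zc : 'I_n -> 'rV[R]_(n + n) -> R) :
  AM c -> dom c (slit_proj u) -> local_expr (slit_chart c) u energy h ->
  (forall u, fibre u (Y u)) -> (forall u, fibre u (Z u)) ->
  (forall i, local_expr (slit_chart c) u
    (fun u' => Y u' (fun q => coord c q 0 i)) (Yc i)) ->
  (forall i, local_expr (slit_chart c) u
    (fun u' => Z u' (fun q => coord c q 0 i)) (Zc i)) ->
  local_expr (slit_chart c) u (fun u' => g u' (Y u') (Z u'))
    (fun z => 2^-1 * \sum_j \sum_k Yc j z * Zc k z * pdy j (pdy k h) z).
Proof.
move=> Ac cu hE fY fZ YE ZE.
have [W [Wo Wu sh near]] := smooth_at_near compS (slit_chart_atlas Ac) hE.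
have HE j k : local_expr (slit_chart c) u
    (fun u' => pdy j (pdy k h) (coord (slit_chart c) u')) (pdy j (pdy k h)).
  by exists W; split => //; do 2!apply: smooth_on_partial.
apply: (local_expr_sub Wo Wu _ (local_exprM (local_expr_cst _ u 2^-1)
  (local_expr_sum (fun j => local_expr_sum (fun k =>
    local_exprM (local_exprM (YE j) (ZE k)) (HE j k)))))).
move=> u' cu' Wu'; have [_ _ hE'] := near u' cu' Wu'.
rewrite (finsler_metricE Ac cu' hE' (fY u') (fZ u')); apply: congr1.
apply: eq_bigr => j _; apply: eq_bigr => k _.
by rewrite !mxE.
Qed.

Lemma finsler_metric_smooth_at u Y Z : pi_vfield Y -> pi_vfield Z ->
  smooth_at SA u (fun u' => g u' (Y u') (Z u')).
Proof.
move=> pY pZ; have [c Ac cu] := chart_ex (slit_proj u).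
have [h hE] := energy_local_expr Ac cu.
have [Yc YE] := pi_vfield_coord Ac cu pY.
have [Zc ZE] := pi_vfield_coord Ac cu pZ.
apply: (local_expr_smooth_at compS (slit_chart_atlas Ac) cu).
exact: (finsler_metric_local_expr Ac cu hE pY.1 pZ.1 YE ZE).
Qed.

(* x^i y^j z^k d^3 h / dy^i dy^j dy^k at [a]; for [h] the square of [L] this is
   four times the Cartan tensor. *)
Definition cubic (h : 'rV[R]_(n + n) -> R) (a : 'rV[R]_(n + n))
    (x y z : 'rV[R]_n) : R :=
  \sum_j \sum_k y 0 j * z 0 k * 'D_(row_mx 0 x) (pdy j (pdy k h)) a.

Lemma cubicE W h a x y z : open W -> W a -> smooth_on W h -> cubic h a x y z =
  \sum_i \sum_j \sum_k x 0 i * y 0 j * z 0 k * pdy i (pdy j (pdy k h)) a.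
Proof.
move=> Wo Wa sh; rewrite exchange_big /cubic /=; apply: eq_bigr => j _.
rewrite exchange_big /=; apply: eq_bigr => k _.
rewrite derive_vertical; last first.
  by apply: (smooth_on_differentiable _ Wa); do 2!apply: smooth_on_partial.
by rewrite mulr_sumr; apply: eq_bigr => i _; ring.
Qed.

Lemma cubic_sym W h a x y z : open W -> W a -> smooth_on W h ->
  cubic h a x y z = cubic h a y x z.
Proof.
move=> Wo Wa sh; rewrite !(cubicE _ _ _ Wo Wa sh) [RHS]exchange_big /=.
apply: eq_bigr => i _; apply: eq_bigr => j _; apply: eq_bigr => k _.
rewrite [y 0 j * _]mulrC.
exact: congr1 (schwarz _ _ Wo (smooth_on_partial _ sh) Wa).
Qed.

(** The left-hand side is the vertical derivative of the energy in the radial direction [eta u]. On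
    the radial curve the energy is (1 + t)^2 times its value at [u], with derivative 2 at t = 0. *)
Lemma energy_euler c u h : AM c -> dom c (slit_proj u) ->
  local_expr (slit_chart c) u energy h ->
  \sum_j coord (slit_chart c) u 0 (rshift n j) *
    pdy j h (coord (slit_chart c) u) = 2 * h (coord (slit_chart c) u).
Proof.
move=> Ac cu hE; set a := coord (slit_chart c) u.
have dh := local_expr_differentiable hE.
have fw := eta_fibre u.
have := derive_vertical (vcoord c (eta u)) dh.
under [X in _ = X]eq_bigr do
  rewrite -(row_mxEr (coord c (slit_proj u))) -coord_slit.
move=> <-.
have [_ <-] := gamma_curve Ac cu fw hE.
have curve : \forall t \near (0 : R), (1 + t) ^+ 2 * h a =
    oapp energy 0 (insub (slit_proj u, eta u + t *: eta u) : option (slit M)).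
  (* Homogeneity of [L] is available for positive factors only, hence [t] near 0. *)
  near=> t.
  have t0 : 0 < 1 + t.
    rewrite -ltrBlDl sub0r; near: t; exact: lt_nbhsr.
  have tE : eta u + t *: eta u = (1 + t) *: eta u by rewrite scalerDl scale1r.
  have ut : (slit_proj u, eta u + t *: eta u) \in @slit_set R n M.
    rewrite inE; split => /=; rewrite tE; first exact: tangentZ.
    move/eqP; rewrite scaler_eq0 gt_eqF //= => /eqP; exact: eta_neq0.
  rewrite insubT /= /energy.
  rewrite -[h a](@local_expr_val _ _ _ (slit_chart c) _ _ _ cu hE) /energy.
  case: finL => _ _ homL _.
  by rewrite /slit_proj /eta /= tE homL // exprMn.
rewrite -(near_eq_derive _ curve).
have d1 : is_derive (0 : R) (1 : R) (cst (1 : R) + id) 1.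
  by apply: is_derive_eq; rewrite add0r.
have [_] := is_deriveM (is_deriveX 2 d1) (is_derive_cst (h a) (0 : R) (1 : R)).
rewrite scaler0 add0r /= /cst /= => E.
have -> : (fun t : R => (1 + t) ^+ 2 * h a) = ((cst 1 + id) ^+ 2 * cst (h a))%R.
  by [].
rewrite E /GRing.add /= addr0 expr1 mulr1 [LHS]mulrC.
by congr (_ * _); rewrite [_ *: 1]mulr1.
Unshelve. all: by end_near.
Qed.

(** The energy has degree 2 in the fibre coordinates and each derivative lowers the degree by one;
    Euler's relation for the second derivatives, of degree 0, is the claim. *)
Lemma energy_cubic_eta c u h y z : AM c -> dom c (slit_proj u) ->
  local_expr (slit_chart c) u energy h ->
  cubic h (coord (slit_chart c) u) (vcoord c (eta u)) y z = 0.
Proof.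
move=> Ac cu hE; set a := coord (slit_chart c) u.
have [W [Wo Wu sh near]] := smooth_at_near compS (slit_chart_atlas Ac) hE.
have [_ /(_ _ (slit_chart_atlas Ac)) imo _] := compS.
(* Euler's relation for [h] is known only at coordinates of points of the slit bundle; these form an
   open set. *)
pose W' := W `&` (coord (slit_chart c) @` dom (slit_chart c)).
have W'o : open W' by exact: openI.
have W'a : W' a by split => //; exists u.
have sh' : smooth_on W' h by apply: smooth_on_sub sh => x [].
have e2 x : W' x -> \sum_j x 0 (rshift n j) * pdy j h x = 2 * h x.
  move=> [Wx [u' cu' u'x]]; subst x; have [_ _ hE'] := near u' cu' Wx.
  exact: energy_euler Ac cu' hE'.
have e1 k := euler_partial k W'o sh' e2.
have e0 j k := euler_partial j W'o (smooth_on_partial _ sh') (e1 k) W'a.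
rewrite (cubicE _ _ _ W'o W'a sh') exchange_big /=; apply: big1 => j _.
rewrite exchange_big /=; apply: big1 => k _.
transitivity (y 0 j * z 0 k *
  \sum_i a 0 (rshift n i) * pdy i (pdy j (pdy k h)) a).
  rewrite mulr_sumr; apply: eq_bigr => i _.
  by rewrite /a coord_slit row_mxEr; ring.
by rewrite e0; ring.
Qed.

(** * Torsion of the Cartan connection in coordinates *)

Section Cartan.
Variable D : connection M.
Hypothesis cartanD : cartan_connection L D.

Lemma cartan_linear : linear_connection D. Proof. by case: cartanD. Qed.
Lemma cartan_regular : regular D. Proof. by case: cartanD. Qed.
Local Notation linD := cartan_linear.
Local Notation regD := cartan_regular.

Lemma sub2_double (G t p q : R) :
  G - (t + p) - (t + q) = 0 -> 2 * t = G - p - q.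
Proof. by move=> E; apply/esym/eqP; rewrite -subr_eq0 -E; apply/eqP; ring. Qed.

Lemma cartan_Ttor_metric X Y Z u : pi_vfield X -> pi_vfield Y -> pi_vfield Z ->
  2 * g u (Ttor D X Y u) (Z u) =
  gamma u (X u) (fun u' => g u' (Y u') (Z u'))
  - g u (vderiv X Y u) (Z u) - g u (Y u) (vderiv X Z u).
Proof.
move=> pX pY pZ; have [_ _ met _ sym] := cartanD.
have pTY := Ttor_pi_vfield linD regD pX pY.
have pTZ := Ttor_pi_vfield linD regD pX pZ.
have pvY := vderiv_pi_vfield pX pY.
have pvZ := vderiv_pi_vfield pX pZ.
have := met _ _ _ (gammaF_vfield pX) pY pZ u.
rewrite (cov_gammaF linD regD pX pY) (cov_gammaF linD regD pX pZ).
rewrite (finsler_metricDl (pTY.1 u) (pvY.1 u) (pZ.1 u)).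
rewrite (finsler_metricDr (pY.1 u) (pTZ.1 u) (pvZ.1 u)).
(* The symmetry axiom makes the two torsion terms of the metricity equation equal, whence the factor
   2. *)
rewrite (finsler_metricC (pY.1 u) (pTZ.1 u)) -(sym X Y Z pX pY pZ u).
exact: sub2_double.
Qed.

Lemma leibniz_cancel (y z H dy dz dH : R) :
  y * z * dH + H * (y * dz + z * dy) - dy * z * H - y * dz * H = y * z * dH.
Proof. by ring. Qed.

(** By the product rule, the terms in which the components of [Y] or [Z] are differentiated cancel
    against the two [vderiv] terms; only the derivative of the coefficients of [g] is left. The
    factor 2^-1 is the one in the metric. *)
Lemma cartan_Ttor_cubic c u h X Y Z : AM c -> dom c (slit_proj u) ->
  local_expr (slit_chart c) u energy h ->
  pi_vfield X -> pi_vfield Y -> pi_vfield Z ->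
  2 * g u (Ttor D X Y u) (Z u) = 2^-1 * cubic h (coord (slit_chart c) u)
    (vcoord c (X u)) (vcoord c (Y u)) (vcoord c (Z u)).
Proof.
move=> Ac cu hE pX pY pZ; rewrite (cartan_Ttor_metric u pX pY pZ).
have [Yc YE] := pi_vfield_coord Ac cu pY.
have [Zc ZE] := pi_vfield_coord Ac cu pZ.
have gE := finsler_metric_local_expr Ac cu hE pY.1 pZ.1 YE ZE.
have pvY := vderiv_pi_vfield pX pY.
have pvZ := vderiv_pi_vfield pX pZ.
rewrite (gammaE Ac cu (pX.1 u) gE).
rewrite (finsler_metricE Ac cu hE (pvY.1 u) (pZ.1 u)).
rewrite (finsler_metricE Ac cu hE (pY.1 u) (pvZ.1 u)).
have [W [Wo Wu sh _]] := hE.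
set a := coord (slit_chart c) u; set w := row_mx 0 (vcoord c (X u)).
have dY j : derivable (Yc j) a w.
  exact/diff_derivable/(local_expr_differentiable (YE j)).
have dZ k : derivable (Zc k) a w.
  exact/diff_derivable/(local_expr_differentiable (ZE k)).
have dH j k : derivable (pdy j (pdy k h)) a w.
  apply/diff_derivable/(smooth_on_differentiable _ Wu).
  by do 2!apply: smooth_on_partial.
have Ya j : Yc j a = vcoord c (Y u) 0 j.
  by rewrite mxE (@local_expr_val _ _ _ (slit_chart c) _ _ _ cu (YE j)).
have Za k : Zc k a = vcoord c (Z u) 0 k.
  by rewrite mxE (@local_expr_val _ _ _ (slit_chart c) _ _ _ cu (ZE k)).
have vY j : vcoord c (vderiv X Y u) 0 j = 'D_w (Yc j) a.
  by rewrite mxE (vderiv_coord Ac cu (pX.1 u) (YE j)).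
have vZ k : vcoord c (vderiv X Z u) 0 k = 'D_w (Zc k) a.
  by rewrite mxE (vderiv_coord Ac cu (pX.1 u) (ZE k)).
have dYZ j k := derivableM (dY j) (dZ k).
have dYZH j k := derivableM (dYZ j k) (dH j k).
have dS j : derivable (\sum_k (Yc j * Zc k * (pdy j (pdy k h)))) a w.
  by apply: derivable_sum => k; exact: dYZH.
have -> : (fun z => 2^-1 * \sum_j \sum_k Yc j z * Zc k z * pdy j (pdy k h) z) =
    2^-1 \*: \sum_j \sum_k (Yc j * Zc k * (pdy j (pdy k h))).
  apply/funext => z; apply: (congr1 (fun r => 2^-1 * r)); rewrite fct_sumE.
  by apply: eq_bigr => j _; rewrite fct_sumE.
rewrite (deriveZ _ (derivable_sum dS)) (derive_sum dS).
rewrite -[_ *: _]/(_ * _) -!mulrBr; apply: congr1.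
rewrite /cubic -!sumrB; apply: eq_bigr => j _.
rewrite (derive_sum (dYZH j)) -!sumrB; apply: eq_bigr => k _.
rewrite (deriveM (dYZ j k) (dH j k)) (deriveM (dY j) (dZ k)).
rewrite vY vZ -Ya -Za; exact: leibniz_cancel.
Qed.

Lemma metric_nondegenerate X u : fibre u (X u) ->
  g u (X u) (X u) = 0 -> X u = 0.
Proof.
move=> fX g0; apply: contrapT => X0; case: finL => _ _ _ /(_ u (X u) fX X0).
by rewrite g0 ltxx.
Qed.

(** Take Z := X and use positivity of [g]. *)
Lemma pi_vfield_eq0 X : pi_vfield X ->
  (forall Z, pi_vfield Z -> forall u, g u (X u) (Z u) = 0) -> forall u, X u = 0.
Proof.
by move=> pX X0 u; apply: metric_nondegenerate (X0 X pX u); exact: pX.1.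
Qed.

Lemma cartan_TtorC X Y u : pi_vfield X -> pi_vfield Y ->
  Ttor D X Y u = Ttor D Y X u.
Proof.
move=> pX pY; have pXY := Ttor_pi_vfield linD regD pX pY.
have pYX := Ttor_pi_vfield linD regD pY pX.
apply/eqP; rewrite -subr_eq0; apply/eqP; move: u.
apply: (pi_vfield_eq0 (pi_vfieldB pXY pYX)) => Z pZ u.
have [c Ac cu] := chart_ex (slit_proj u).
have [h hE] := energy_local_expr Ac cu.
have [W [Wo Wu sh _]] := hE.
have two0 : (2 : R) != 0 by rewrite pnatr_eq0.
apply: (mulfI two0); rewrite mulr0.
rewrite (finsler_metricBl (pXY.1 u) (pYX.1 u) (pZ.1 u)) mulrBr.
apply: etrans (congr2 (fun r s => r - s) (cartan_Ttor_cubic Ac cu hE pX pY pZ)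
  (cartan_Ttor_cubic Ac cu hE pY pX pZ)) _.
rewrite (cubic_sym (vcoord c (X u)) _ _ Wo Wu sh); exact: subrr.
Qed.

(** Symmetry moves [eta] to the first argument, the direction of the outermost derivative in
    [cubic], where Euler's relation applies. *)
Lemma cartan_Ttor_eta X u : pi_vfield X -> Ttor D X eta u = 0.
Proof.
have pe := @eta_pi_vfield R n M; move=> pX; rewrite (cartan_TtorC u pX pe).
move: u; apply: (pi_vfield_eq0 (Ttor_pi_vfield linD regD pe pX)) => Z pZ u.
have [c Ac cu] := chart_ex (slit_proj u).
have [h hE] := energy_local_expr Ac cu.
have two0 : (2 : R) != 0 by rewrite pnatr_eq0.
apply: (mulfI two0); rewrite (cartan_Ttor_cubic Ac cu hE pe pX pZ).
by rewrite (energy_cubic_eta _ _ Ac cu hE) !mulr0.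
Qed.

Lemma cartan_Kmap_gamma X u : pi_vfield X -> Kmap D u (gammaF X u) = X u.
Proof.
have pe := @eta_pi_vfield R n M; move=> pX.
rewrite /Kmap -[LHS]/(cov D (gammaF X) eta u) (cov_gammaF linD regD pX pe).
by rewrite cartan_Ttor_eta // add0r vderiv_eta.
Qed.

End Cartan.
End FinslerMetric.

(** * Conformal changes *)

Section ConformalChange.
Context {R : realType} {n : nat} {M : manifold R n}.

Notation AM := (@atlas R n M).
Notation SA := (@slit_atlas R n M).
Implicit Types (u : slit M) (X Y Z : slit M -> tvec R M).

Variables (L L' : M -> tvec R M -> R) (D D' : connection M).
Hypotheses (finL : is_finsler L) (finL' : is_finsler L').
Hypotheses (cartanD : cartan_connection L D).
Hypotheses (cartanD' : cartan_connection L' D').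
Hypothesis confL : conformal L L'.

Let linD := cartan_linear cartanD.
Let regD := cartan_regular cartanD.
Let linD' := cartan_linear cartanD'.
Let regD' := cartan_regular cartanD'.

(* The conformal factor is constant on the fibres, so the vertical derivative
   of the metric is rescaled by the same factor as the metric. *)
Lemma conformal_Ttor X Y : pi_vfield X -> pi_vfield Y ->
  Ttor D' X Y = Ttor D X Y.
Proof.
move=> pX pY; have [sigma [_ _ conf]] := confL.
have pT := Ttor_pi_vfield linD regD pX pY.
have pT' := Ttor_pi_vfield linD' regD' pX pY.
apply/funext => u; apply/eqP; rewrite -subr_eq0; apply/eqP; move: u.
apply: (pi_vfield_eq0 finL' (pi_vfieldB pT' pT)) => Z pZ u.
rewrite (finsler_metricBl finL' (pT'.1 u) (pT.1 u) (pZ.1 u)).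
apply/eqP; rewrite subr_eq0; apply/eqP.
have two0 : (2 : R) != 0 by rewrite pnatr_eq0.
apply: (mulfI two0).
have E := cartan_Ttor_metric finL cartanD u pX pY pZ.
have E' := cartan_Ttor_metric finL' cartanD' u pX pY pZ.
have pvY := vderiv_pi_vfield pX pY.
have pvZ := vderiv_pi_vfield pX pZ.
pose phi p := expR (2 * sigma p).
have gE : (fun u' => finsler_metric L' u' (Y u') (Z u')) =
    (fun u' => phi (slit_proj u') * finsler_metric L u' (Y u') (Z u')).
  by apply/funext => u'; exact: conf (pY.1 u') (pZ.1 u').
have sg : smooth_at SA u _ := finsler_metric_smooth_at finL pY pZ.
have sg' : smooth_at SA u _ := finsler_metric_smooth_at finL' pY pZ.
rewrite gE in sg'.
rewrite gE (gamma_fibrewise_scale (pX.1 u) sg sg') in E'.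
rewrite (conf u _ _ (pvY.1 u) (pZ.1 u)) (conf u _ _ (pY.1 u) (pvZ.1 u)) in E'.
apply: etrans E' _; rewrite -!mulrBr -E.
by rewrite (conf u _ _ (pT.1 u) (pZ.1 u)) mulrCA.
Qed.

(** Each side is the common [T] plus [vderiv X Y], which involves no connection. *)
Lemma conn_gammaF_eq X Y u : pi_vfield X -> pi_vfield Y ->
  cov D' (gammaF X) Y u = cov D (gammaF X) Y u.
Proof.
move=> pX pY; rewrite (cov_gammaF linD' regD' pX pY) (cov_gammaF linD regD pX pY).
by rewrite conformal_Ttor.
Qed.

Lemma Nmap_pi_vfield X : pi_vfield X -> pi_vfield (Nmap D D' X).
Proof.
move=> pX; have vb := betaF_vfield regD pX; have pe := @eta_pi_vfield R n M.
exact: pi_vfieldB (conn_pi_vfield linD' vb pe) (conn_pi_vfield linD vb pe).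
Qed.

(** As K(beta X) = 0, N X is the value of [Kmap D'] on beta X. It is also its value on gamma N X, so
    the difference is horizontal for [D']; its image under [rho] is X because [rho] kills gamma N
    X. *)
Lemma conformal_betaF X u : pi_vfield X ->
  betaF D' X u = betaF D X u - gammaF (Nmap D D' X) u.
Proof.
move=> pX; have pN := Nmap_pi_vfield pX; have pe := @eta_pi_vfield R n M.
have [hb' rb'] := betaP regD' (pX.1 u).
have [[tb Kb] rb] := betaP regD (pX.1 u).
have tg : tangent SA u (gammaF (Nmap D D' X) u) by exact/gamma_tangent/pN.1.
apply: (horizontal_inj linD' regD' hb').
- split; first exact: tangentB.
  rewrite /Kmap (connBv linD' tb tg pe).
  rewrite -[X in _ - X]/(Kmap D' u (gammaF (Nmap D D' X) u)).
  rewrite (cartan_Kmap_gamma finL' cartanD' u pN).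
  rewrite /Nmap /Bdiff /cov -[D u _ eta]/(Kmap D u (beta D u (X u))) Kb subr0.
  exact: subrr.
- by rewrite rhoB (rho_gamma (pN.1 u)) subr0 rb' rb.
Qed.

(** By linearity [D'] along beta' X is [D'] along beta X minus [D'] along gamma N X, and the latter
    agrees with [D]: these are the terms of [Udiff]. *)
Lemma conformal_cov_betaF X Y : pi_vfield X -> pi_vfield Y ->
  cov D' (betaF D' X) Y = fun u => cov D (betaF D X) Y u + Udiff D D' X Y u.
Proof.
move=> pX pY; have pN := Nmap_pi_vfield pX; apply/funext => u.
rewrite /Udiff -conn_gammaF_eq // /Bdiff addrA [_ + (_ - _)]addrC subrK.
rewrite {1}/cov conformal_betaF //; apply: connBv => //.
  exact: (betaF_tangent regD u pX).
exact/gamma_tangent/pN.1.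
Qed.

Lemma Udiff_pi_vfield X Y : pi_vfield X -> pi_vfield Y ->
  pi_vfield (Udiff D D' X Y).
Proof.
move=> pX pY.
have -> : Udiff D D' X Y =
    fun u => cov D' (betaF D' X) Y u - cov D (betaF D X) Y u.
  by apply/funext => u; rewrite conformal_cov_betaF // addrC addKr.
apply: pi_vfieldB; apply: conn_pi_vfield => //; exact: betaF_vfield.
Qed.

(** The summands [b], [r], [s] stand for the contributions of [Udiff]; [r + s - b] becomes
    [Acal]. *)
Lemma covT_regroup (V : zmodType) (a b p q r s : V) :
  a + b - (p + r) - (q + s) = a - p - q - (r + s - b).
Proof.
by rewrite !opprD opprK !addrA [LHS](ACl (1*3*5*4*6*2)).
Qed.

Lemma conformal_covT X Y Z u : pi_vfield X -> pi_vfield Y -> pi_vfield Z ->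
  covT D' (betaF D' X) Y Z u = covT D (betaF D X) Y Z u - Acal D D' X Y Z u.
Proof.
move=> pX pY pZ; have vb := betaF_vfield regD pX; have vb' := betaF_vfield regD' pX.
have pcY := conn_pi_vfield linD vb pY; have pcZ := conn_pi_vfield linD vb pZ.
have pcY' := conn_pi_vfield linD' vb' pY; have pcZ' := conn_pi_vfield linD' vb' pZ.
have pUY := Udiff_pi_vfield pX pY; have pUZ := Udiff_pi_vfield pX pZ.
have pT := Ttor_pi_vfield linD regD pY pZ.
rewrite /covT !conformal_Ttor // conformal_cov_betaF //.
rewrite (conformal_cov_betaF pX pY) (conformal_cov_betaF pX pZ).
rewrite (TtorDl linD regD u pcY pUY pZ).
(* Symmetry brings the sum to the first argument, where [T] is additive, and leaves the [Udiff] term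
   in the order used by [Acal]. *)
rewrite (cartan_TtorC finL cartanD u pY (pi_vfieldD pcZ pUZ)).
rewrite (TtorDl linD regD u pcZ pUZ pY).
rewrite -(cartan_TtorC finL cartanD u pY pcZ) /Acal.
exact: covT_regroup.
Qed.

End ConformalChange.

Theorem proposition3p19 (R : realType) (n : nat) (M : manifold R n)
    (L L' : M -> tvec R M -> R) (D D' : connection M) :
  is_finsler L -> is_finsler L' ->
  cartan_connection L D -> cartan_connection L' D' ->
  conformal L L' ->
  (forall X Y Z : slit M -> tvec R M,
     pi_vfield X -> pi_vfield Y -> pi_vfield Z ->
     forall u, Acal D D' X Y Z u = 0%R) ->
  (berwald D <-> berwald D') /\ (Ch_recurrent D <-> Ch_recurrent D').
Proof.
move=> finL finL' cartanD cartanD' confL A0.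
have covTE X Y Z u : pi_vfield X -> pi_vfield Y -> pi_vfield Z ->
    covT D' (betaF D' X) Y Z u = covT D (betaF D X) Y Z u.
  move=> pX pY pZ.
  rewrite (conformal_covT finL finL' cartanD cartanD' confL u pX pY pZ).
  by rewrite (A0 X Y Z pX pY pZ u) subr0.
have TE := conformal_Ttor finL finL' cartanD cartanD' confL.
split; split.
- by move=> B X Y Z pX pY pZ u; rewrite covTE //; exact: B.
- by move=> B X Y Z pX pY pZ u; rewrite -covTE //; exact: B.
(* The same recurrence form serves both structures, since [T] and its horizontal derivative
   coincide. *)
- move=> [lam plam H]; exists lam => // X Y Z pX pY pZ u.
  by rewrite covTE // TE //; exact: H.
- move=> [lam plam H]; exists lam => // X Y Z pX pY pZ u.
  by rewrite -covTE // -TE //; exact: H.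
Qed.
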